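(* Let $\mathcal S$ be one of the categories $\mathcal{PF}$, $\mathcal{EF}$, $\mathcal{RB}$ (the preordering Frobenius monad, the equivalential Frobenius monad, and the relational bialgebraic monad, respectively, freely generated by a single object), and let $v,w$ be arrow terms of $\mathcal S$ of the same type (same source and same target). If $v=w$ does not hold in $\mathcal S$, then the category $\mathcal S+\{v=w\}$ is a preorder, i.e. there is at most one arrow with a given source and a given target in $\mathcal S+\{v=w\}$.
   Context: Notation: $\circ$ is composition of arrows; $\mathbf 1$ denotes identity arrows; for a natural transformation $\theta$ and functors $F,M$, $\theta_F$ has components $\theta_{Fa}$ and $M\theta$ has components $M(\theta_a)$; $I$ is the identity functor. **Common structure.** Each structure below consists of a category with an endofunctor $M$ and natural transformations $\nabla:MM\to M$, $\Delta:M\to MM$, $u:I\to M$, $\varepsilon:M\to I$, $\tau:MM\to MM$ satisfying: (Monad) $\nabla\circ\nabla_M=\nabla\circ M\nabla$, $\nabla\circ u_M=\mathbf 1_M=\nabla\circ Mu$; (Comonad) $\Delta_M\circ\Delta=M\Delta\circ\Delta$, $\varepsilon_M\circ\Delta=\mathbf 1_M=M\varepsilon\circ\Delta$; (Symmetry) $\tau\circ\tau=\mathbf 1_{MM}$, $M\tau\circ\tau_M\circ M\tau=\tau_M\circ M\tau\circ\tau_M$, $\nabla\circ\tau=\nabla$, $\tau\circ\Delta=\Delta$, $\tau\circ\nabla_M=M\nabla\circ\tau_M\circ M\tau$, $\Delta_M\circ\tau=M\tau\circ\tau_M\circ M\Delta$, $\tau\circ u_M=Mu$, $\varepsilon_M\circ\tau=M\varepsilon$;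 (Separability) $\nabla\circ\Delta=\mathbf 1_M$; (Unit-counit homomorphism) $\varepsilon\circ u=\mathbf 1_I$. **Relational bialgebraic monad:** the common structure with, moreover, $\varepsilon\circ\nabla=\varepsilon\circ M\varepsilon$, $\Delta\circ u=Mu\circ u$, $\Delta\circ\nabla=M\nabla\circ\nabla_{MM}\circ M\tau_M\circ MM\Delta\circ\Delta_M$. **Equivalential Frobenius monad:** the common structure with, moreover, the Frobenius equations $M\nabla\circ\Delta_M=\Delta\circ\nabla=\nabla_M\circ M\Delta$. **Preordering Frobenius monad:** an equivalential Frobenius monad with an additional natural transformation $\downarrow:M\to M$ such that $\downarrow\circ\downarrow=\downarrow$; $\tau\circ\downarrow_M=M{\downarrow}\circ\tau$; $\nabla\circ M{\downarrow}\circ\uparrow_M\circ\Delta=\mathbf 1_M$, where $\uparrow\;=M\varepsilon\circ M\nabla\circ M{\downarrow}_M\circ\Delta_M\circ u_M$; and, with $\nabla^\downarrow=\nabla\circ M{\downarrow}\circ\downarrow_M$ and $\Delta^\downarrow=M{\downarrow}\circ\downarrow_M\circ\Delta$: $\varepsilon\circ\nabla^\downarrow=\varepsilon\circ M\varepsilon$, $\Delta^\downarrow\circ u=Mu\circ u$, $\Delta^\downarrow\circ\nabla^\downarrow=M\nabla^\downarrow\circ\nabla^\downarrow_{MM}\circ M\tau_M\circ MM\Delta^\downarrow\circ\Delta^\downarrow_M$, $\nabla^\downarrow\circ\Delta^\downarrow=\downarrow$. **The free categories.** For each of these three notions, the category $\mathcal S$ freely generated by one object $0$ has as objects $M^n0$,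 identified with $n\ge0$. Its arrow terms are built from identities $\mathbf 1_n:n\to n$ and the components at each $n$: $\nabla_n:n+2\to n+1$, $\Delta_n:n+1\to n+2$, $u_n:n\to n+1$, $\varepsilon_n:n+1\to n$, $\tau_n:n+2\to n+2$ (and $\downarrow_n:n+1\to n+1$ for $\mathcal{PF}$), by composition and by $f:n\to m\ \mapsto\ Mf:n+1\to m+1$. Arrows of $\mathcal S$ are equivalence classes of arrow terms under the least congruence (for composition and $M$) validating the category axioms, functoriality of $M$, naturality of the listed transformations, and the equations of the corresponding notion at all objects. **$\mathcal S+\{v=w\}$.** It is defined exactly as $\mathcal S$, with $v=w$ added as a new axiomatic equation, where the equations (including the new one) are taken to be closed under: composition; ''if $f=g$ then $Mf=Mg$''; and ''if $f=g$ then $f_m=g_m$'' for every $m\ge0$, where $f_m$ is obtained from the arrow term $f$ by replacing every component $\theta_k$ in it by $\theta_{k+m}$ (and $\mathbf 1_k$ by $\mathbf 1_{k+m}$); that is, the equations are understood as equations between natural transformations. *)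

(* Defs.v *)
From mathcomp Require Import all_boot boolp.

Set Implicit Arguments.
Unset Strict Implicit.
Unset Printing Implicit Defensive.

(* PF: preordering Frobenius monad, EF: equivalential Frobenius monad,
   RB: relational bialgebraic monad. *)
Inductive notion := PF | EF | RB.

Declare Scope term_scope.
Delimit Scope term_scope with term.

(* The object M^n 0 is represented by n, so the functor M is the successor on
   objects.  For a transformation t, the component of t_M at n is t n.+1 and
   that of M t is M (t n).  The transformation u : I -> M is called eta. *)
Inductive term : notion -> nat -> nat -> Type :=
| idt K n : term K n n
| compt K a b c : term K b c -> term K a b -> term K a c
| M K a b : term K a b -> term K a.+1 b.+1
| nabla K n : term K n.+2 n.+1
| Delta K n : term K n.+1 n.+2
| eta K n : term K n n.+1
| eps K n : term K n.+1 n
| tau K n : term K n.+2 n.+2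
| down n : term PF n.+1 n.+1.

Arguments idt {K} n.
Arguments nabla {K} n.
Arguments Delta {K} n.
Arguments eta {K} n.
Arguments eps {K} n.
Arguments tau {K} n.
Bind Scope term_scope with term.

Notation "g ∘ f" := (compt g f) (at level 40, left associativity) : term_scope.
Local Open Scope term_scope.

(* shift f m is the term f_m; n.+1 + m and (n + m).+1 are convertible. *)
Fixpoint shift K a b (f : term K a b) (m : nat) : term K (a + m) (b + m) :=
  match f in term K a b return term K (a + m) (b + m) with
  | idt K n => idt (n + m)
  | compt K a b c g f => shift g m ∘ shift f m
  | M K a b f => M (shift f m)
  | nabla K n => nabla (n + m)
  | Delta K n => Delta (n + m)
  | eta K n => eta (n + m)
  | eps K n => eps (n + m)
  | tau K n => tau (n + m)
  | down n => down (n + m)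
  end.

Definition trel (K : notion) := forall a b, term K a b -> term K a b -> Prop.

Inductive common_ax (K : notion) : trel K :=
| ax_comp1t a b (f : term K a b) : common_ax (idt b ∘ f) f
| ax_compt1 a b (f : term K a b) : common_ax (f ∘ idt a) f
| ax_compA a b c d (h : term K c d) (g : term K b c) (f : term K a b) :
    common_ax (h ∘ (g ∘ f)) ((h ∘ g) ∘ f)
| ax_M1 n : common_ax (M (idt n)) (idt n.+1)
| ax_MM a b c (g : term K b c) (f : term K a b) :
    common_ax (M (g ∘ f)) (M g ∘ M f)
| ax_nabla_nat a b (f : term K a b) :
    common_ax (nabla b ∘ M (M f)) (M f ∘ nabla a)
| ax_Delta_nat a b (f : term K a b) :
    common_ax (Delta b ∘ M f) (M (M f) ∘ Delta a)
| ax_unit_nat a b (f : term K a b) : common_ax (eta b ∘ f) (M f ∘ eta a)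
| ax_eps_nat a b (f : term K a b) : common_ax (eps b ∘ M f) (f ∘ eps a)
| ax_tau_nat a b (f : term K a b) :
    common_ax (tau b ∘ M (M f)) (M (M f) ∘ tau a)
| ax_nablaA n : common_ax (nabla n ∘ nabla n.+1) (nabla n ∘ M (nabla n))
| ax_nabla_unit n : common_ax (nabla n ∘ eta n.+1) (idt n.+1)
| ax_nabla_Munit n : common_ax (nabla n ∘ M (eta n)) (idt n.+1)
| ax_DeltaA n : common_ax (Delta n.+1 ∘ Delta n) (M (Delta n) ∘ Delta n)
| ax_eps_Delta n : common_ax (eps n.+1 ∘ Delta n) (idt n.+1)
| ax_Meps_Delta n : common_ax (M (eps n) ∘ Delta n) (idt n.+1)
| ax_tauK n : common_ax (tau n ∘ tau n) (idt n.+2)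
| ax_tau_braid n :
    common_ax (M (tau n) ∘ tau n.+1 ∘ M (tau n))
              (tau n.+1 ∘ M (tau n) ∘ tau n.+1)
| ax_nabla_tau n : common_ax (nabla n ∘ tau n) (nabla n)
| ax_tau_Delta n : common_ax (tau n ∘ Delta n) (Delta n)
| ax_tau_nabla n :
    common_ax (tau n ∘ nabla n.+1) (M (nabla n) ∘ tau n.+1 ∘ M (tau n))
| ax_Delta_tau n :
    common_ax (Delta n.+1 ∘ tau n) (M (tau n) ∘ tau n.+1 ∘ M (Delta n))
| ax_tau_unit n : common_ax (tau n ∘ eta n.+1) (M (eta n))
| ax_eps_tau n : common_ax (eps n.+1 ∘ tau n) (M (eps n))
| ax_separable n : common_ax (nabla n ∘ Delta n) (idt n.+1)
| ax_eps_unit n : common_ax (eps n ∘ eta n) (idt n).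

Inductive bialgebra_ax (K : notion) : trel K :=
| ax_eps_nabla n : bialgebra_ax (eps n ∘ nabla n) (eps n ∘ M (eps n))
| ax_Delta_unit n : bialgebra_ax (Delta n ∘ eta n) (M (eta n) ∘ eta n)
| ax_Delta_nabla n :
    bialgebra_ax (Delta n ∘ nabla n)
      (M (nabla n) ∘ nabla n.+2 ∘ M (tau n.+1) ∘ M (M (Delta n))
        ∘ Delta n.+1).

Inductive frobenius_ax (K : notion) : trel K :=
| ax_frobenius_l n :
    frobenius_ax (M (nabla n) ∘ Delta n.+1) (Delta n ∘ nabla n)
| ax_frobenius_r n :
    frobenius_ax (Delta n ∘ nabla n) (nabla n.+1 ∘ M (Delta n)).

Definition up n : term PF n.+1 n.+1 :=
  M (eps n) ∘ M (nabla n) ∘ M (down n.+1) ∘ Delta n.+1 ∘ eta n.+1.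

Definition nablad n : term PF n.+2 n.+1 := nabla n ∘ M (down n) ∘ down n.+1.

Definition Deltad n : term PF n.+1 n.+2 := M (down n) ∘ down n.+1 ∘ Delta n.

Inductive preordering_ax : trel PF :=
| ax_down_nat a b (f : term PF a b) :
    preordering_ax (down b ∘ M f) (M f ∘ down a)
| ax_downK n : preordering_ax (down n ∘ down n) (down n)
| ax_tau_down n : preordering_ax (tau n ∘ down n.+1) (M (down n) ∘ tau n)
| ax_down_up n :
    preordering_ax (nabla n ∘ M (down n) ∘ up n.+1 ∘ Delta n) (idt n.+1)
| ax_eps_nablad n : preordering_ax (eps n ∘ nablad n) (eps n ∘ M (eps n))
| ax_Deltad_unit n :
    preordering_ax (Deltad n ∘ eta n) (M (eta n) ∘ eta n)
| ax_Deltad_nablad n :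
    preordering_ax (Deltad n ∘ nablad n)
      (M (nablad n) ∘ nablad n.+2 ∘ M (tau n.+1) ∘ M (M (Deltad n))
        ∘ Deltad n.+1)
| ax_nablad_Deltad n : preordering_ax (nablad n ∘ Deltad n) (down n).

Definition ax (K : notion) : trel K :=
  match K return trel K with
  | PF => fun a b f g =>
      [\/ common_ax f g, frobenius_ax f g | preordering_ax f g]
  | EF => fun a b f g => common_ax f g \/ frobenius_ax f g
  | RB => fun a b f g => common_ax f g \/ bialgebra_ax f g
  end.

Inductive free_eq (K : notion) : trel K :=
| free_ax a b (f g : term K a b) : ax f g -> free_eq f g
| free_refl a b (f : term K a b) : free_eq f f
| free_sym a b (f g : term K a b) : free_eq f g -> free_eq g f
| free_trans a b (f g h : term K a b) :
    free_eq f g -> free_eq g h -> free_eq f h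
| free_comp a b c (g g' : term K b c) (f f' : term K a b) :
    free_eq g g' -> free_eq f f' -> free_eq (g ∘ f) (g' ∘ f')
| free_M a b (f g : term K a b) : free_eq f g -> free_eq (M f) (M g).

(* Equality of arrow terms in S + {v = w}: by ext_shift, the equations are
   equations between natural transformations. *)
Inductive ext_eq (K : notion) (p q : nat) (v w : term K p q) : trel K :=
| ext_ax a b (f g : term K a b) : ax f g -> ext_eq v w f g
| ext_new : ext_eq v w v w
| ext_refl a b (f : term K a b) : ext_eq v w f f
| ext_sym a b (f g : term K a b) : ext_eq v w f g -> ext_eq v w g f
| ext_trans a b (f g h : term K a b) :
    ext_eq v w f g -> ext_eq v w g h -> ext_eq v w f h
| ext_comp a b c (g g' : term K b c) (f f' : term K a b) :
    ext_eq v w g g' -> ext_eq v w f f' -> ext_eq v w (g ∘ f) (g' ∘ f')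
| ext_M a b (f g : term K a b) : ext_eq v w f g -> ext_eq v w (M f) (M g)
| ext_shift a b (f g : term K a b) (m : nat) :
    ext_eq v w f g -> ext_eq v w (shift f m) (shift g m).

Record congruence (K : notion) := Congruence {
  crel : trel K;
  c_ax : forall a b (f g : term K a b), ax f g -> crel f g;
  c_refl : forall a b (f : term K a b), crel f f;
  c_sym : forall a b (f g : term K a b), crel f g -> crel g f;
  c_trans : forall a b (f g h : term K a b),
    crel f g -> crel g h -> crel f h;
  c_comp : forall a b c (g g' : term K b c) (f f' : term K a b),
    crel g g' -> crel f f' -> crel (g ∘ f) (g' ∘ f');
  c_M : forall a b (f g : term K a b), crel f g -> crel (M f) (M g) }.

Definition free_cong (K : notion) : congruence K :=
  Congruence (@free_ax K) (@free_refl K) (@free_sym K) (@free_trans K)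
    (@free_comp K) (@free_M K).

Definition ext_cong (K : notion) p q (v w : term K p q) : congruence K :=
  Congruence (@ext_ax K p q v w) (@ext_refl K p q v w) (@ext_sym K p q v w)
    (@ext_trans K p q v w) (@ext_comp K p q v w) (@ext_M K p q v w).

Record category := Category {
  obj : Type;
  hom : obj -> obj -> Type;
  idm : forall a, hom a a;
  comp : forall a b c, hom b c -> hom a b -> hom a c;
  comp1m : forall a b (f : hom a b), comp (idm b) f = f;
  compm1 : forall a b (f : hom a b), comp f (idm a) = f;
  compmA : forall a b c d (h : hom c d) (g : hom b c) (f : hom a b),
    comp h (comp g f) = comp (comp h g) f }.

Definition preorder (C : category) : Prop :=
  forall (a b : obj C) (f g : hom a b), f = g.

Section Quotient.

Variables (K : notion) (R : congruence K).

Definition arrow (a b : nat) :=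
  {F : term K a b -> Prop | exists f, F = crel R f}.

Definition class a b (f : term K a b) : arrow a b :=
  exist _ (crel R f) (ex_intro _ f erefl).

Definition repr a b (F : arrow a b) : term K a b := sval (cid (svalP F)).

Lemma reprK a b (F : arrow a b) : class (repr F) = F.
Proof.
rewrite /repr; case: cid => f /= eF.
by case: F eF => F exF /= eF; apply: eq_exist.
Qed.

Lemma classP a b (f g : term K a b) : class f = class g <-> crel R f g.
Proof.
split=> [/(congr1 sval) /= ->|Rfg]; first exact: c_refl.
apply: eq_exist; apply/predeqP => h; split=> [Rfh|].
  exact: c_trans (c_sym Rfg) Rfh.
exact: c_trans.
Qed.

Definition id_arrow a : arrow a a := class (idt a).

(* Independent of the representatives, by comp_class. *)
Definition comp_arrow a b c (G : arrow b c) (F : arrow a b) : arrow a c :=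
  class (repr G ∘ repr F).

Lemma comp_class a b c (g : term K b c) (f : term K a b) :
  comp_arrow (class g) (class f) = class (g ∘ f).
Proof. by apply/classP; apply: c_comp; apply/classP; rewrite reprK. Qed.

Lemma common_c a b (f g : term K a b) : common_ax f g -> crel R f g.
Proof.
move=> h; apply: c_ax; case: K f g h => f g h;
  by [exact: Or31 | exact: or_introl].
Qed.

Lemma comp1_arrow a b (F : arrow a b) : comp_arrow (id_arrow b) F = F.
Proof.
by rewrite -(reprK F) comp_class; apply/classP/common_c; constructor.
Qed.

Lemma comp_arrow1 a b (F : arrow a b) : comp_arrow F (id_arrow a) = F.
Proof.
by rewrite -(reprK F) comp_class; apply/classP/common_c; constructor.
Qed.

Lemma comp_arrowA a b c d (H : arrow c d) (G : arrow b c) (F : arrow a b) :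
  comp_arrow H (comp_arrow G F) = comp_arrow (comp_arrow H G) F.
Proof.
rewrite -(reprK F) -(reprK G) -(reprK H) !comp_class.
by apply/classP/common_c; constructor.
Qed.

Definition quotient : category :=
  Category comp1_arrow comp_arrow1 comp_arrowA.

End Quotient.

(* ext_category v w is S + {v = w}, where S is free_category K. *)
Definition free_category (K : notion) : category := quotient (free_cong K).

Definition ext_category (K : notion) p q (v w : term K p q) : category :=
  quotient (ext_cong v w).

(* Main.v *)
Require Import Defs.
From mathcomp Require Import all_boot boolp.

(** An arrow from a to b is drawn as a diagram with a wires at the source and b
wires at the target; the wire 0 is the outermost one, on which nabla, Delta,
eta, eps and tau act. The proof has no semantics in it. It gives every arrow a
normal form that is provably equal to it, and two distinct normal forms
differ in a place where their equation, composed with generators, yields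
eta . eps = 1; as the equations of the extension are stable under shift, this
holds at all objects. Every arrow then factors through the object 0, which has
a single endomorphism, and the extension is a preorder (collapse).

Frobenius monads. An arrow from p to q is bent into a state, an arrow from 0
to p + q (bendK), so that states are enough. A state is read as a formula
whose free variables are its wires: eta introduces a variable, eps is an
existential quantifier, nabla and Delta identify variables. The atoms are the
edges x <= y, built from the order down in PF and from the equality of x and
y in EF. Edges commute, and they are natural with respect to every arrow that
connects wires (edge_link). Hence eta, nabla, Delta and tau keep a state equal
to a conjunction of edges; so does down, a fresh wire joined by an edge to the
given one, which is then dropped, provided that eps does. This is quantifier
elimination: in EF a quantified variable is replaced by one that is equal to it (EF_elim);
in PF a variable k with L <= k <= U is removed in favour of all the edges
from L to U (below_above), which is the bialgebra law iterated. So every state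
is a conjunction of edges (state_graph) and is determined by the edges that
it absorbs (state_ext).

Edges absorbed by a state form a preorder. If s and t are distinct states,
one of them, say s, absorbs an edge from x to y that t does not absorb. Under
the equation s = t, merge the wires of t above x into one wire and the other
wires into another. No edge of t leads from the first to the second, but the
edge from x to y now does and is absorbed (split_spider). What remains says
that down is eta . eps in PF, and that 1 is eta . eps in EF; in PF the axiom
on up then yields 1 = eta . eps (split_spider_collapse).

Relational bialgebraic monads. Every arrow is given by a Boolean matrix: each
target wire is the sum of a set of source wires (matP). Two matrices that
differ in the entry at (i, j) are told apart by feeding the wire i alone and
observing the wire j alone, which gives 1 on one side and eta . eps on the
other (mat_collapse). *)

Set Implicit Arguments.
Unset Strict Implicit.
Unset Printing Implicit Defensive.

(** * Arrows and their generators *)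

Section Operations.

Variables (K : notion) (R : congruence K).

Definition idA n : arrow R n n := id_arrow R n.
Definition MA a b (f : arrow R a b) : arrow R a.+1 b.+1 :=
  class R (M (Defs.repr f)).
Definition nabA n : arrow R n.+2 n.+1 := class R (nabla n).
Definition DelA n : arrow R n.+1 n.+2 := class R (Delta n).
Definition etaA n : arrow R n n.+1 := class R (eta n).
Definition epsA n : arrow R n.+1 n := class R (eps n).
Definition tauA n : arrow R n.+2 n.+2 := class R (tau n).

End Operations.

Notation "g ⊙ f" := (comp_arrow g f) (at level 41, right associativity).
Notation "'M'' f" := (MA f) (at level 10, f at level 9).
Notation "'𝟏'" := (idA _ _).
Notation "'∇'" := (nabA _ _).
Notation "'Δ'" := (DelA _ _).
Notation "'η'" := (etaA _ _).
Notation "'ε'" := (epsA _ _).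
Notation "'τ'" := (tauA _ _).

(** Reads the wire x into a new outermost wire. With no wire to read, a fresh one
is produced, which is counital and commutes with copies. *)
Fixpoint copy_term K n x : term K n n.+1 :=
  match n with
  | 0 => eta 0
  | n.+1 => if x is x.+1 then compt (tau n) (M (copy_term K n x)) else Delta n
  end.
Arguments copy_term {K} n x.

(** The relation that an edge imposes on its two ends: the order in PF, equality
in EF. *)
Definition order_term K n : term K n.+1 n.+1 :=
  match K with PF => down n | EF => idt n.+1 | RB => idt n.+1 end.

Fixpoint fresh_term K n : term K 0 n :=
  if n is n.+1 then compt (eta n) (fresh_term K n) else idt 0.

(** Equates the outermost wire with the wire y of the others and drops it. *)
Definition match_term K n y : term K n.+1 n :=
  compt (eps n) (compt (nabla n) (M (copy_term n y))).

Definition edge_term K n x y : term K n n :=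
  compt (match_term K n y) (compt (order_term K n) (copy_term n x)).

Fixpoint edges_term K n (G : seq (nat * nat)) : term K n n :=
  if G is e :: G then compt (edge_term K n e.1 e.2) (edges_term K n G)
  else idt n.

Definition in_range n (e : nat * nat) := (e.1 < n) && (e.2 < n).

(** * Equational calculus *)

Section Calculus.

Variables (K : notion) (R : congruence K).

Local Notation H := (arrow R).

Lemma class_comp a b c (g : term K b c) (f : term K a b) :
  class R (compt g f) = class R g ⊙ class R f.
Proof. by rewrite comp_class. Qed.

Lemma class_M a b (f : term K a b) : class R (M f) = M' (class R f).
Proof. by apply/classP/c_M/classP; rewrite Defs.reprK. Qed.

Lemma arrow_ind (P : forall a b, H a b -> Prop) :
  (forall a b (f : term K a b), P a b (class R f)) ->
  forall a b (f : H a b), P a b f.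
Proof. by move=> h a b f; rewrite -(Defs.reprK f). Qed.

Lemma common_eq a b (f g : term K a b) :
  common_ax f g -> class R f = class R g.
Proof. by move=> h; apply/classP/common_c. Qed.

Lemma compA a b c e (h : H c e) (g : H b c) (f : H a b) :
  (h ⊙ g) ⊙ f = h ⊙ g ⊙ f.
Proof. by rewrite comp_arrowA. Qed.

Lemma comp1f a b (f : H a b) : 𝟏 ⊙ f = f.
Proof. exact: comp1_arrow. Qed.

Lemma compf1 a b (f : H a b) : f ⊙ 𝟏 = f.
Proof. exact: comp_arrow1. Qed.

Lemma M1 n : M' (idA R n) = 𝟏.
Proof. by rewrite /idA /id_arrow -class_M; apply: common_eq; constructor. Qed.

Lemma MM a b c (g : H b c) (f : H a b) : M' (g ⊙ f) = M' g ⊙ M' f.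
Proof.
elim/arrow_ind: g => b' c' g in f *; elim/arrow_ind: f g => a' b'' f g.
by rewrite -!(class_comp, class_M); apply: common_eq; constructor.
Qed.

Ltac by_ax :=
  rewrite /nabA /DelA /etaA /epsA /tauA /idA /id_arrow;
  rewrite -?(class_M, class_comp) -?(class_M, class_comp);
  apply: common_eq; constructor.
Ltac nat_ax f := elim/arrow_ind: f => a' b' f; by_ax.

Lemma nab_nat a b (f : H a b) : ∇ ⊙ M' (M' f) = M' f ⊙ ∇.
Proof. nat_ax f. Qed.
Lemma Del_nat a b (f : H a b) : M' (M' f) ⊙ Δ = Δ ⊙ M' f.
Proof. by symmetry; nat_ax f. Qed.
Lemma eta_nat a b (f : H a b) : M' f ⊙ η = η ⊙ f.
Proof. by symmetry; nat_ax f. Qed.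
Lemma eps_nat a b (f : H a b) : ε ⊙ M' f = f ⊙ ε.
Proof. nat_ax f. Qed.
Lemma tau_nat a b (f : H a b) : τ ⊙ M' (M' f) = M' (M' f) ⊙ τ.
Proof. nat_ax f. Qed.

Lemma nabAss n : nabA R n ⊙ ∇ = ∇ ⊙ M' ∇.
Proof. by_ax. Qed.
Lemma nab_eta n : nabA R n ⊙ η = 𝟏.
Proof. by_ax. Qed.
Lemma nab_Meta n : nabA R n ⊙ M' η = 𝟏.
Proof. by_ax. Qed.
Lemma DelAss n : Δ ⊙ DelA R n = M' Δ ⊙ Δ.
Proof. by_ax. Qed.
Lemma eps_Del n : ε ⊙ DelA R n = 𝟏.
Proof. by_ax. Qed.
Lemma Meps_Del n : M' ε ⊙ DelA R n = 𝟏.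
Proof. by_ax. Qed.
Lemma tauK n : tauA R n ⊙ τ = 𝟏.
Proof. by_ax. Qed.
Lemma braid n : M' (tauA R n) ⊙ τ ⊙ M' τ = τ ⊙ M' τ ⊙ τ.
Proof. rewrite -!compA; by_ax. Qed.
Lemma nab_tau n : nabA R n ⊙ τ = ∇.
Proof. by_ax. Qed.
Lemma tau_Del n : τ ⊙ DelA R n = Δ.
Proof. by_ax. Qed.
Lemma tau_nab n : tauA R n ⊙ ∇ = M' ∇ ⊙ τ ⊙ M' τ.
Proof. rewrite -!compA; by_ax. Qed.
Lemma Del_tau n : Δ ⊙ tauA R n = M' τ ⊙ τ ⊙ M' Δ.
Proof. rewrite -!compA; by_ax. Qed.
Lemma tau_eta n : tauA R n ⊙ η = M' η.
Proof. by_ax. Qed.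
Lemma eps_tau n : ε ⊙ tauA R n = M' ε.
Proof. by_ax. Qed.
Lemma sepA n : nabA R n ⊙ Δ = 𝟏.
Proof. by_ax. Qed.
Lemma eps_eta n : epsA R n ⊙ η = 𝟏.
Proof. by_ax. Qed.

(** Composites are kept associated to the right, so an equation is applied inside
a longer composite in whiskered form. The digits count the arrows in its two
sides; a single digit allows any right-hand side. *)
Lemma w2 a b c (f : H b c) (g : H a b) h (E : f ⊙ g = h) e (x : H e a) :
  f ⊙ g ⊙ x = h ⊙ x.
Proof. by rewrite -compA E. Qed.

Lemma w22 a b c b' (f : H b c) (g : H a b) (h : H b' c) (k : H a b')
  (E : f ⊙ g = h ⊙ k) e (x : H e a) :
  f ⊙ g ⊙ x = h ⊙ k ⊙ x.
Proof. by rewrite -!compA E. Qed.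

Lemma w23 a b c b' c' (f : H b c) (g : H a b) (h : H c' c) (k : H b' c')
  (l : H a b') (E : f ⊙ g = h ⊙ k ⊙ l) e (x : H e a) :
  f ⊙ g ⊙ x = h ⊙ k ⊙ l ⊙ x.
Proof. by rewrite -compA E !compA. Qed.

Lemma w3 a b c e (f : H b c) (g : H a b) (k : H e a) h
  (E : f ⊙ g ⊙ k = h) i (x : H i e) :
  f ⊙ g ⊙ k ⊙ x = h ⊙ x.
Proof. by rewrite -E !compA. Qed.

Lemma m2 a b c (f : H b c) (g : H a b) h :
  f ⊙ g = h -> M' f ⊙ M' g = M' h.
Proof. by rewrite -MM => ->. Qed.

Lemma tauKx n e (x : H e n.+2) : τ ⊙ τ ⊙ x = x.
Proof. by rewrite (w2 (tauK _)) comp1f. Qed.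
Lemma MtauKx n e (x : H e n.+3) : M' τ ⊙ M' τ ⊙ x = x.
Proof. by rewrite (w2 (m2 (tauK _))) M1 comp1f. Qed.

Lemma tau_Meta n : tauA R n ⊙ M' η = η.
Proof. by rewrite -tau_eta -compA tauK comp1f. Qed.
Lemma Meps_tau n : M' ε ⊙ tauA R n = ε.
Proof. by rewrite -eps_tau compA tauK compf1. Qed.

Lemma braidx n e (x : H e n.+3) :
  M' τ ⊙ τ ⊙ M' τ ⊙ x = τ ⊙ M' τ ⊙ τ ⊙ x.
Proof. by rewrite (w3 (braid _)) !compA. Qed.

Lemma Mnab_tau n : M' (nabA R n) ⊙ τ = τ ⊙ ∇ ⊙ M' τ.
Proof. by rewrite (w23 (tau_nab _)) -MM tauK M1 compf1. Qed.

Lemma MDel_tau n : M' Δ ⊙ tauA R n = τ ⊙ M' τ ⊙ Δ.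
Proof.
have := Del_tau n => /(congr1 (fun h => τ ⊙ M' τ ⊙ h ⊙ tauA R n)).
by rewrite !compA tauK compf1 => ->; rewrite MtauKx tauKx.
Qed.

Definition cp n x : H n n.+1 := class R (copy_term n x).

Lemma cp0 n : cp n.+1 0 = Δ. Proof. by []. Qed.
Lemma cpS n x : cp n.+1 x.+1 = τ ⊙ M' (cp n x).
Proof. by rewrite -class_M -class_comp. Qed.
Lemma cp_nil x : cp 0 x = η. Proof. by []. Qed.

(** The order in which the two wires are adjoined is immaterial. *)
Definition comm n (r s : H n n.+1) := M' r ⊙ s = τ ⊙ M' s ⊙ r.

Lemma comm_sym n (r s : H n n.+1) : comm r s -> comm s r.
Proof. by rewrite /comm => ->; rewrite tauKx. Qed.

Lemma comm_eta n (s : H n n.+1) : comm η s.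
Proof. by rewrite /comm (eta_nat s) (w2 (tau_eta _)). Qed.

Lemma comm_nab n (r s t : H n n.+1) :
  comm r t -> comm s t -> comm (∇ ⊙ M' r ⊙ s) t.
Proof.
rewrite /comm => rt st; rewrite -(w22 (nab_nat t)) !MM.
rewrite !compA st.
have := rt; move/(congr1 (fun f => M' f)); rewrite !MM => rt'.
rewrite -(w22 (tau_nat r)) (w23 rt').
by rewrite (w23 (tau_nab _)).
Qed.

Lemma cp_comm n x y : comm (cp n x) (cp n y).
Proof.
elim: n x y => [|n IHn] [|x] [|y]; rewrite /comm.
1-4: exact: comm_eta.
- by rewrite !cp0 -DelAss (w2 (tau_Del _)) DelAss.
- rewrite cp0 cpS MM (w23 (MDel_tau _)) !compA.
  by rewrite -(Del_nat (cp n y)).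
- rewrite cp0 cpS MM !compA (w23 (MDel_tau _)) tauKx.
  by rewrite -(Del_nat (cp n x)).
- have xy := IHn x y; rewrite !cpS !MM !compA.
  rewrite -!(w22 (tau_nat _)).
  have := xy; move/(congr1 (fun f => M' f)); rewrite !MM => ->.
  by rewrite braidx.
Qed.

Lemma eps_cp n x : ε ⊙ cp n x = 𝟏.
Proof.
elim: n x => [|n IHn] [|x].
1,2: by rewrite cp_nil eps_eta.
  by rewrite cp0 eps_Del.
by rewrite cpS (w2 (eps_tau _)) -MM IHn M1.
Qed.

Lemma Del_cp n x : x < n -> Δ ⊙ cp n x = M' (cp n x) ⊙ cp n x.
Proof.
elim: n x => [//|n IHn] [_|x xn]; first by rewrite cp0 DelAss.
rewrite cpS MM !compA -(w22 (tau_nat _)) -MM -IHn // MM.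
by rewrite (w23 (Del_tau _)).
Qed.

(** The wire i of the source runs through f to the wire j of the target. *)
Definition link a b (f : H a b) i j := cp b j ⊙ f = M' f ⊙ cp a i.

Lemma link_id n i : link (idA R n) i i.
Proof. by rewrite /link M1 comp1f compf1. Qed.

Lemma link_comp a b c (g : H b c) (f : H a b) i j k :
  link f i j -> link g j k -> link (g ⊙ f) i k.
Proof. by rewrite /link MM !compA => <- gjk; rewrite (w2 gjk) compA. Qed.

Lemma link_M0 a b (f : H a b) : link (M' f) 0 0.
Proof. by rewrite /link !cp0 Del_nat. Qed.

Lemma link_MS a b (f : H a b) i j : link f i j -> link (M' f) i.+1 j.+1.
Proof.
rewrite /link !cpS !compA => ij.
by rewrite -MM ij MM (w22 (tau_nat f)).
Qed.

Lemma link_eta n i : link (etaA R n) i i.+1.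
Proof. by rewrite /link cpS !compA eta_nat (w2 (tau_eta _)). Qed.

Lemma link_eps n i : link (epsA R n) i.+1 i.
Proof. by rewrite /link cpS (w2 (Meps_tau _)) eps_nat. Qed.

Definition swap01 i := if i is i'.+1 then (if i' is 0 then 0 else i) else 1.

Lemma link_tau n i : link (tauA R n) i (swap01 i).
Proof.
rewrite /link; case: i => [|[|i]]; rewrite /= ?cpS ?cp0 ?MM ?compA.
- by rewrite MDel_tau tauKx.
- by rewrite Del_tau.
- by rewrite -(tau_nat (cp n i)) -braidx.
Qed.

Lemma link_Del n i : link (DelA R n) i i.+1.
Proof.
case: i => [|i]; rewrite /link !cpS ?cp0 ?compA.
  by rewrite -DelAss (w2 (tau_Del _)).
by rewrite MM compA (w23 (MDel_tau _)) Del_nat.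
Qed.

Lemma link_cp n y i : link (cp n y) i i.+1.
Proof. by rewrite /link cpS compA; exact/esym/cp_comm. Qed.

Lemma link_cp0 n y : y < n -> link (cp n y) y 0.
Proof. by move=> yn; rewrite /link cp0 Del_cp. Qed.

End Calculus.

(** * Edges between wires *)

Section Frobenius.

Variables (K : notion) (R : congruence K).
Hypothesis hK : K <> RB.

Local Notation H := (arrow R).
Local Notation cp := (cp R).

Lemma frob_eq a b (f g : term K a b) :
  frobenius_ax f g -> class R f = class R g.
Proof.
move=> h; apply/classP/c_ax; case: K R hK f g h => // R' _ f g h.
  exact: Or32.
exact: or_intror.
Qed.

Lemma frobL n : M' ∇ ⊙ DelA R n.+1 = Δ ⊙ ∇.
Proof. by rewrite -class_M -!class_comp; apply: frob_eq; constructor. Qed.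

Lemma frobR n : ∇ ⊙ M' (DelA R n) = Δ ⊙ ∇.
Proof. by rewrite -class_M -!class_comp; apply/esym/frob_eq; constructor. Qed.

Definition dA n : H n.+1 n.+1 := class R (order_term K n).
Local Notation "'δ'" := (dA _).

(** Since dA is down in PF and an identity otherwise, one induction principle
serves the three notions. *)
Lemma generated_ind (P : forall a b, H a b -> Prop) :
    (forall n, P n n 𝟏) ->
    (forall a b c (g : H b c) (f : H a b),
       P _ _ g -> P _ _ f -> P _ _ (g ⊙ f)) ->
    (forall a b (f : H a b), P _ _ f -> P _ _ (M' f)) ->
    (forall n, P _ _ (nabA R n)) -> (forall n, P _ _ (DelA R n)) ->
    (forall n, P _ _ (etaA R n)) -> (forall n, P _ _ (epsA R n)) ->
    (forall n, P _ _ (tauA R n)) -> (forall n, P _ _ (dA n)) ->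
  forall a b (f : H a b), P a b f.
Proof.
move=> P1 Pc PM Pn PD Pu Pe Pt Pd a b f; rewrite -(Defs.reprK f).
move: (Defs.repr f) => {f} t.
rewrite /dA in Pd; elim: t R P P1 Pc PM Pn PD Pu Pe Pt Pd =>
  [? n|? ? ? ? g IHg f IHf|? ? ? f IHf|? n|? n|? n|? n|? n|n]
  R' P P1 Pc PM Pn PD Pu Pe Pt Pd //.
- have Pg := IHg R' P P1 Pc PM Pn PD Pu Pe Pt Pd.
  have Pf := IHf R' P P1 Pc PM Pn PD Pu Pe Pt Pd.
  by rewrite class_comp; apply: Pc.
- have Pf := IHf R' P P1 Pc PM Pn PD Pu Pe Pt Pd.
  by rewrite class_M; apply: PM.
Qed.

Lemma d_nat a b (f : H a b) : M' f ⊙ δ = δ ⊙ M' f.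
Proof.
elim/arrow_ind: f => {}a {}b f; rewrite /dA -class_M.
case: K R hK f => // R' _ f.
  rewrite -!class_comp; apply/esym/classP/c_ax/Or33; constructor.
by rewrite /= -!/(idA R' _) comp1f compf1.
Qed.

Lemma tau_d' n : τ ⊙ dA n.+1 = M' δ ⊙ τ.
Proof.
rewrite /dA -class_M; case: K R hK => // R' _.
  rewrite -!class_comp; apply/classP/c_ax/Or33; constructor.
by rewrite class_M /= -!/(idA R' _) M1 comp1f compf1.
Qed.

Lemma tau_d n : τ ⊙ M' (dA n) = δ ⊙ τ.
Proof. by rewrite -[δ ⊙ τ]tauKx (w22 (tau_d' _)) (tauK R) compf1. Qed.

Definition cap n y : H n.+1 n := class R (match_term K n y).
Lemma capE n y : cap n y = ε ⊙ ∇ ⊙ M' (cp n y).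
Proof. by rewrite /cap /match_term !class_comp class_M. Qed.

Definition edge n x y : H n n := class R (edge_term K n x y).
Lemma edgeE n x y : edge n x y = cap n y ⊙ δ ⊙ cp n x.
Proof. exact: etrans (class_comp _ _ _) (congr1 _ (class_comp _ _ _)). Qed.

Lemma link_nab n i : link (nabA R n) i i.-1.
Proof.
case: i => [|[|i]]; rewrite /link /= ?cpS ?cp0 ?MM ?compA.
- by rewrite frobL.
- by rewrite (w23 (Mnab_tau _ _)) -MM tau_Del frobR (w2 (tau_Del _ _)).
- by rewrite -(nab_nat (cp n i)) (w23 (tau_nab _ _)).
Qed.

Lemma link_d n i : link (dA n) i.+1 i.+1.
Proof.
by rewrite /link cpS compA d_nat (w22 (tau_d' _)).
Qed.

Lemma link_cap n y i : link (cap n y) i.+1 i.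
Proof.
rewrite capE; apply: link_comp (link_eps R n i).
by apply: link_comp (link_MS (link_cp R n y i)) (link_nab _ i.+2).
Qed.

Lemma link_edge n x y i : link (edge n x y) i i.
Proof.
rewrite edgeE; apply: link_comp (link_cap _ _ _).
by apply: link_comp (link_cp _ _ _ _) (link_d _ _).
Qed.

Lemma cap_link a b (f : H a b) j j' :
  link f j j' -> cap b j' ⊙ M' f = f ⊙ cap a j.
Proof.
rewrite /link !capE !compA -MM => ->.
by rewrite MM (w22 (nab_nat f)) (w22 (eps_nat f)).
Qed.

(** Both ends of an edge are read by copies, and a link moves a copy through f;
the middle of the edge is natural. *)
Lemma edge_link a b (f : H a b) i i' j j' :
  link f i i' -> link f j j' -> f ⊙ edge a i j = edge b i' j' ⊙ f.
Proof.
move=> fi fj; rewrite !edgeE !compA fi -(w22 (d_nat f)).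
by rewrite (w22 (cap_link fj)).
Qed.

Lemma edge_comm n x y z t :
  edge n x y ⊙ edge n z t = edge n z t ⊙ edge n x y.
Proof. by apply: edge_link; apply: link_edge. Qed.

Lemma capS n y : cap n.+1 y.+1 = M' (cap n y) ⊙ τ.
Proof.
rewrite !capE cpS !MM !compA -(tau_nat (cp n y)).
by rewrite (w23 (Mnab_tau _ _)) (w2 (Meps_tau _ _)).
Qed.

Lemma cap0 n : cap n.+1 0 = ∇.
Proof. by rewrite capE cp0 frobR (w2 (eps_Del _ _)) comp1f. Qed.

Lemma M_edge n x y : M' (edge n x y) = edge n.+1 x.+1 y.+1.
Proof.
by rewrite !edgeE !MM capS cpS compA (w22 (tau_d' _)) tauKx.
Qed.

Lemma edge0S n y : edge n.+1 0 y.+1 = M' (cap n y ⊙ δ) ⊙ Δ.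
Proof. by rewrite edgeE capS cp0 MM !compA (w22 (tau_d' _)) tau_Del. Qed.

Lemma edgeS0 n x : edge n.+1 x.+1 0 = ∇ ⊙ M' (δ ⊙ cp n x).
Proof. by rewrite edgeE cap0 cpS -(w22 (tau_d _)) (w2 (nab_tau _ _)) MM. Qed.

Lemma cp_cap n y : y < n -> cp n y ⊙ cap n y = ∇ ⊙ M' (cp n y).
Proof.
move=> yn; rewrite capE -(w22 (eps_nat (cp n y))) -(w22 (nab_nat (cp n y))).
by rewrite -MM -Del_cp // MM (w22 (frobR _)) (w2 (eps_Del _ _)) comp1f.
Qed.

(** A product is tested against y by testing its factors against two copies of y,
by the Frobenius law. *)
Lemma cap_nab n y : y < n -> cap n y ⊙ ∇ = cap n y ⊙ M' (cap n y).
Proof.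
move=> yn; rewrite {1 2}capE !compA -MM cp_cap // MM.
by rewrite -(nab_nat (cp n y)) (w22 (nabAss _ _)).
Qed.

(** The edge for equality, whatever the notion. *)
Definition eqv n x y : H n n := cap n y ⊙ cp n x.

(** Substitution of z for a fresh wire that is equated with it. *)
Lemma eqv_eta n z : eqv n.+1 0 z.+1 ⊙ η = cp n z.
Proof.
rewrite /eqv capS cp0 !compA (w2 (tau_Del _ _)) capE !MM !compA.
rewrite (w22 (Del_nat (cp n z))) eta_nat (w22 (frobL _)) (w2 (Meps_Del _ _)).
by rewrite comp1f (w2 (nab_eta _ _)) comp1f.
Qed.

Lemma eqv_sym n x y : eqv n x y = eqv n y x.
Proof.
by rewrite /eqv !capE !compA (cp_comm R n y x) (w2 (nab_tau _ _)).
Qed.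

Lemma eqv_refl n x : x < n -> eqv n x x = 𝟏.
Proof.
move=> xn; rewrite /eqv capE !compA -Del_cp // (w2 (sepA _ _)) comp1f.
exact: eps_cp.
Qed.

(** Frobenius turns either side into the copy of the common value of x and y. *)
Lemma cp_eqv n x y : x < n -> y < n ->
  cp n x ⊙ eqv n x y = cp n y ⊙ eqv n x y.
Proof.
move=> xn yn; rewrite {1}eqv_sym /eqv (w22 (cp_cap xn)) (w22 (cp_cap yn)).
by rewrite (cp_comm R n x y) (w2 (nab_tau _ _)).
Qed.

Definition fresh n : H 0 n := class R (fresh_term K n).
Lemma freshS n : fresh n.+1 = η ⊙ fresh n.
Proof. exact: class_comp. Qed.

Definition edges n G : H n n := class R (edges_term K n G).
Lemma edges_cons n e G : edges n (e :: G) = edge n e.1 e.2 ⊙ edges n G.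
Proof. exact: class_comp. Qed.

Lemma edges_cat n G G' : edges n (G ++ G') = edges n G ⊙ edges n G'.
Proof. by elim: G => [|e G IH]; rewrite ?comp1f //= !edges_cons IH compA. Qed.

Lemma edges_edge n G x y : edge n x y ⊙ edges n G = edges n G ⊙ edge n x y.
Proof.
elim: G => [|e G IH]; first by rewrite comp1f compf1.
by rewrite !edges_cons compA -IH -!compA edge_comm.
Qed.

Lemma edges_comm n G G' : edges n G ⊙ edges n G' = edges n G' ⊙ edges n G.
Proof.
elim: G => [|e G IH]; first by rewrite comp1f compf1.
by rewrite edges_cons compA IH -!compA edges_edge.
Qed.

Definition map_edge (r : nat -> nat) (e : nat * nat) := (r e.1, r e.2).

(** Edges are pushed forward along a map of wires; edges_colink pulls them back. *)
Lemma edges_link a b (f : H a b) r G :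
    (forall i, i < a -> link f i (r i)) -> all (in_range a) G ->
  f ⊙ edges a G = edges b (map (map_edge r) G) ⊙ f.
Proof.
move=> fr; elim: G => [|e G IH] /=; first by rewrite comp1f compf1.
case/andP=> /andP[e1 e2] /IH eG; rewrite !edges_cons compA -eG -!compA.
by rewrite (edge_link (fr _ e1) (fr _ e2)).
Qed.

Lemma edges_colink a b (f : H a b) r G :
    (forall i, i < b -> link f (r i) i) -> all (in_range b) G ->
  edges b G ⊙ f = f ⊙ edges a (map (map_edge r) G).
Proof.
move=> fr; elim: G => [|e G IH] /=; first by rewrite comp1f compf1.
case/andP=> /andP[e1 e2] /IH eG; rewrite !edges_cons compA eG -!compA.
by rewrite (edge_link (fr _ e1) (fr _ e2)).
Qed.

Lemma edges_M n G : M' (edges n G) = edges n.+1 (map (map_edge S) G).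
Proof. by elim: G => [|e G IH] /=; rewrite ?M1 // !edges_cons MM IH M_edge. Qed.

(** The normal form of states: a conjunction of atoms on n variables. *)
Definition graph_state n (s : H 0 n) :=
  exists2 G, all (in_range n) G & s = edges n G ⊙ fresh n.

Lemma graph_state_edges n G (s : H 0 n) :
  all (in_range n) G -> graph_state s -> graph_state (edges n G ⊙ s).
Proof.
move=> aG [G' aG' ->]; exists (G ++ G'); first by rewrite all_cat aG.
by rewrite edges_cat compA.
Qed.

Lemma graph_state_fresh n : graph_state (fresh n).
Proof. by exists [::] => //; rewrite comp1f. Qed.

Lemma graph_state_M n (s : H 0 n) : graph_state s -> graph_state (η ⊙ s).
Proof.
case=> G aG ->; exists (map (map_edge S) G).
  by rewrite all_map; apply: sub_all aG => e.
by rewrite -edges_M freshS -!compA eta_nat.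
Qed.

(** Arrows that lead old wires to new ones, possibly merging them, and whose
other target wires are subject to edges only. *)
Definition relabel a b (f : H a b) :=
  (exists r, forall i, i < a -> r i < b /\ link f i (r i)) /\
  graph_state (f ⊙ fresh a).

Lemma relabel_state a b (f : H a b) s :
  relabel f -> graph_state s -> graph_state (f ⊙ s).
Proof.
case=> -[r fr] gf [G aG ->]; rewrite -compA (@edges_link _ _ _ r) //; last first.
  by move=> i /fr[].
rewrite compA; apply: graph_state_edges => //.
rewrite all_map; apply: sub_all aG => e.
by case/andP=> /fr[e1 _] /fr[e2 _]; rewrite /in_range /= e1.
Qed.

Lemma relabel_comp a b c (g : H b c) (f : H a b) :
  relabel g -> relabel f -> relabel (g ⊙ f).
Proof.
move=> rg rf; split; last by rewrite compA; apply: relabel_state rg (rf.2).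
case: rg rf => -[r gr] _ [[r' fr] _]; exists (r \o r') => i /fr[+ fi].
by move=> /gr[? gi]; split=> //; apply: link_comp fi gi.
Qed.

Lemma relabel_M a b (f : H a b) : relabel f -> relabel (M' f).
Proof.
case=> -[r fr] gf; split; last first.
  by rewrite freshS -compA eta_nat compA; apply: graph_state_M.
exists (fun i => if i is i.+1 then (r i).+1 else 0) => -[_|i /fr[ri fi]].
  by split=> //; apply: link_M0.
by split=> //; apply: link_MS.
Qed.

Lemma relabel_tau n : relabel (tauA R n).
Proof.
split; last first.
  rewrite !freshS (w2 (tau_eta _ _)) (w22 (eta_nat _)) -!freshS.
  exact: graph_state_fresh.
by exists swap01 => i; split; [case: i H => [|[|]] | exact: link_tau].
Qed.

Lemma relabel_eta n : relabel (etaA R n).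
Proof.
split; last by rewrite -freshS; exact: graph_state_fresh.
by exists S => i; split=> //; apply: link_eta.
Qed.

Lemma relabel_nab n : relabel (nabA R n).
Proof.
split; last first.
  rewrite !freshS (w2 (nab_eta _ _)) comp1f -freshS.
  exact: graph_state_fresh.
by exists predn => i; split; [case: i H | exact: link_nab].
Qed.

End Frobenius.

Notation "'δ'" := (dA _ _).

(* Unfolding composites to sets of terms would make failing unifications very
   slow. *)
Opaque comp_arrow MA.

Lemma EF_RB : EF <> RB. Proof. by []. Qed.
Lemma PF_RB : PF <> RB. Proof. by []. Qed.

(** * Quantifier elimination for equivalence relations *)

Section Equivalential.

Variable R : congruence EF.

Local Notation H := (arrow R).
Local Notation cp := (cp R).
Local Notation edge := (edge R).
Local Notation edges := (edges R).
Local Notation fresh := (fresh R).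

Lemma EF_edge n x y : edge n x y = eqv R n x y.
Proof. by rewrite edgeE -/(idA R _) comp1f. Qed.

Lemma EF_refl n x : x < n -> edge n x x = 𝟏.
Proof. by rewrite EF_edge; exact: eqv_refl. Qed.

(** As x and y are equal in s, so are their copies, and x may replace y in the
second equation. *)
Lemma EF_trans n x y z m (s : H m n) : x < n -> y < n -> z < n ->
  edge n x y ⊙ s = s -> edge n y z ⊙ s = s -> edge n x z ⊙ s = s.
Proof.
move=> xn yn zn xy yz; rewrite -{1}xy !EF_edge {1}/eqv compA.
rewrite (w22 (cp_eqv R EF_RB xn yn)) -(compA (cap _ _ _)).
rewrite -/(eqv _ _ _ _) -!EF_edge.
by rewrite xy.
Qed.

Lemma EF_Del n : graph_state (Δ ⊙ fresh n.+1).
Proof.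
exists [:: (0, 1)] => //.
by rewrite edges_cons compf1 (freshS _ n.+1) EF_edge (w2 (eqv_eta R EF_RB _ _)).
Qed.

(** Either some edge joins the wire 0 to another one, which then replaces it, or
the wire 0 is isolated and can be dropped. *)
Lemma EF_elim n (s : H 0 n.+1) : graph_state s -> graph_state (ε ⊙ s).
Proof.
case=> G aG ->.
have [/hasP[e eG ze]|noze] := boolP (has (fun e => (e.1 == 0) != (e.2 == 0)) G).
  case/splitPr: eG aG => G1 G2; rewrite all_cat /= => /and3P[aG1 ae aG2].
  rewrite edges_cat edges_cons (edges_edge R EF_RB) -(compA (edges _ G1)).
  rewrite -edges_cat !compA.
  have {ae ze}[j jn ->] :
      exists2 j, j < n & edge n.+1 e.1 e.2 = edge n.+1 0 j.+1.
    case: e ae ze => -[|i] [|j] //= /andP[/= i1 j1] _; first by exists j.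
    by exists i => //; rewrite !EF_edge eqv_sym.
  rewrite freshS EF_edge (w2 (eqv_eta R EF_RB _ _)).
  set r := fun i => if i is i.+1 then i else j.
  have rl i : i < n.+1 -> link (cp n j) (r i) i.
    by case: i => [_|i _]; [exact: link_cp0 | exact: link_cp].
  have aG : all (in_range n.+1) (G1 ++ G2) by rewrite all_cat aG1.
  rewrite (w22 (edges_colink EF_RB rl aG)) (w2 (eps_cp _ _ _)) comp1f.
  exists (map (map_edge r) (G1 ++ G2)); last by [].
  rewrite all_map; apply: sub_all aG => -[[|a] [|b]] /=;
    by rewrite /in_range /= ?jn.
have [G' aG' ->] :
    exists2 G', all (in_range n) G' & edges n.+1 G = M' (edges n G').
  elim: G aG noze => [|e G IH] /=; first by exists [::]; rewrite ?M1.
  rewrite negb_or negbK => /andP[ae aG] /andP[ze /(IH aG)[G' aG' eG]].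
  case: e ae ze => -[|i] [|j] //= /andP[/= i1 j1] _; rewrite edges_cons /=.
    by exists G' => //; rewrite EF_refl // comp1f.
  exists ((i, j) :: G'); first by rewrite /= aG' andbT; apply/andP.
  by rewrite eG edges_cons MM (M_edge R EF_RB).
exists G'; first exact: aG'.
by rewrite freshS (w22 (eta_nat _)) (w2 (eps_eta _ _)) comp1f.
Qed.

End Equivalential.

(** * Quantifier elimination for preorders *)

Section Preordering.

Variable R : congruence PF.

Local Notation H := (arrow R).
Local Notation cp := (cp R).
Local Notation cap := (cap R).
Local Notation edge := (edge R).
Local Notation edges := (edges R).
Local Notation fresh := (fresh R).

Let hK := PF_RB.

Lemma pre_eq a b (f g : term PF a b) :
  preordering_ax f g -> class R f = class R g.
Proof. by move=> h; apply/classP/c_ax/Or33. Qed.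

Lemma d_d n : dA R n ⊙ δ = δ.
Proof. by rewrite -!class_comp; apply: pre_eq; constructor. Qed.

Definition nd n : H n.+2 n.+1 := class R (nablad n).
Definition Dd n : H n.+1 n.+2 := class R (Deltad n).

Lemma ndE n : nd n = ∇ ⊙ M' δ ⊙ δ.
Proof. by rewrite /nd /nablad !class_comp class_M compA. Qed.

Lemma DdE n : Dd n = M' δ ⊙ δ ⊙ Δ.
Proof. by rewrite /Dd /Deltad !class_comp class_M compA. Qed.

Lemma eps_nd n : ε ⊙ nd n = ε ⊙ M' ε.
Proof.
by rewrite -class_M -!class_comp; apply: pre_eq; constructor.
Qed.

Lemma Dd_eta n : Dd n ⊙ η = M' η ⊙ η.
Proof.
by rewrite -class_M -!class_comp; apply: pre_eq; constructor.
Qed.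

Lemma nd_Dd n : nd n ⊙ Dd n = δ.
Proof.
by rewrite -!class_comp; apply: pre_eq; constructor.
Qed.

Lemma bialg n :
  Dd n ⊙ nd n = M' (nd n) ⊙ nd _ ⊙ M' τ ⊙ M' (M' (Dd n)) ⊙ Dd _.
Proof.
have split_class (N : forall k, term PF k.+2 k.+1)
    (D : forall k, term PF k.+1 k.+2) :
    class R (M (N n) ∘ N n.+2 ∘ M (tau n.+1) ∘ M (M (D n))
               ∘ D n.+1)%term =
    M' (class R (N n)) ⊙ class R (N n.+2) ⊙ M' τ ⊙
      M' (M' (class R (D n))) ⊙ class R (D n.+1).
  by rewrite !class_comp !class_M !compA.
rewrite -(split_class nablad Deltad) -(class_comp R (Deltad n)).
by apply: pre_eq; constructor.
Qed.

Lemma Md_nat a b (f : H a b) : M' δ ⊙ M' (M' f) = M' (M' f) ⊙ M' δ.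
Proof. by rewrite -!MM (d_nat hK). Qed.

Lemma nd_nat a b (f : H a b) : nd b ⊙ M' (M' f) = M' f ⊙ nd a.
Proof.
rewrite !ndE !compA -(d_nat hK (M' f)) -(w22 (nab_nat f)).
by rewrite (w22 (Md_nat f)).
Qed.

Lemma Dd_nat a b (f : H a b) : M' (M' f) ⊙ Dd a = Dd b ⊙ M' f.
Proof.
rewrite !DdE !compA -(w22 (Md_nat f)) (w22 (d_nat hK (M' f))).
by rewrite (Del_nat f).
Qed.

(** Everything lies below something. A single bound comes from the axiom on two
bounds by taking a fresh wire for one of them. *)
Lemma eps_d n : ε ⊙ dA R n = ε.
Proof.
have E : ε ⊙ nd n ⊙ δ = ε ⊙ nd n by rewrite !ndE !compA d_d.
have := congr1 (fun f => f ⊙ M' η) E.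
rewrite /= !compA !(w22 (eps_nd _)) -(d_nat hK) !(w2 (m2 (eps_eta R _))).
by rewrite -MM eps_eta M1 comp1f compf1.
Qed.

Lemma d_Dd n : δ ⊙ Dd n = Dd n.
Proof. by rewrite !DdE -(w22 (d_nat hK δ)) (w2 (d_d _)). Qed.

Lemma d_eta n : δ ⊙ etaA R n = η.
Proof.
have := congr1 (fun f => M' ε ⊙ f ⊙ η) (d_Dd n).
rewrite /= !compA Dd_eta (w22 (d_nat hK _)) (w2 (m2 (eps_eta R _))).
by rewrite M1 comp1f.
Qed.

Lemma nd_Meta n : nd n ⊙ M' η = δ.
Proof.
rewrite !ndE !compA -(d_nat hK) (w2 (m2 (d_eta _))) (w2 (nab_Meta _ _)).
exact: comp1f.
Qed.

Lemma Meps_Dd n : M' ε ⊙ Dd n = δ.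
Proof.
by rewrite !DdE (w2 (m2 (eps_d _))) (w22 (d_nat hK _)) Meps_Del compf1.
Qed.

Lemma Md_Md n e (x : H e n.+2) : M' δ ⊙ M' δ ⊙ x = M' δ ⊙ x.
Proof. by rewrite (w2 (m2 (d_d _))). Qed.

Lemma Md_d n : M' (dA R n) ⊙ δ = δ ⊙ M' δ.
Proof. exact: d_nat. Qed.

Lemma Md_Dd n : M' δ ⊙ Dd n = Dd n.
Proof. by rewrite DdE Md_Md. Qed.

Lemma Mtau_nat a b (f : H a b) :
  M' τ ⊙ M' (M' (M' f)) = M' (M' (M' f)) ⊙ M' τ.
Proof. by rewrite -!MM tau_nat. Qed.

(** A fresh wire plugged into the bialgebra law leaves only an order step before
Dd; d_nd is dual. *)
Lemma Dd_d n : Dd n ⊙ δ = Dd n.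
Proof.
have := congr1 (fun f => f ⊙ M' η) (bialg n); rewrite /= !compA.
rewrite nd_Meta => ->; rewrite -(Dd_nat η).
rewrite (w2 (m2 (m2 (Dd_eta _)))) !MM !compA (w22 (Mtau_nat η)).
rewrite (w2 (m2 (tau_Meta _ _))) (w22 (nd_nat (M' η))) (w2 (m2 (nd_Meta _))).
by rewrite (w2 (nd_Meta _)) d_Dd Md_Dd.
Qed.

Lemma d_nd n : δ ⊙ nd n = nd n.
Proof.
have := congr1 (fun f => M' ε ⊙ f) (bialg n); rewrite /=.
rewrite (w2 (Meps_Dd _)) => ->.
rewrite (w2 (m2 (eps_nd _))) MM !compA -(w22 (nd_nat (M' ε))).
rewrite -(w22 (Mtau_nat ε)) (w2 (m2 (m2 (Meps_Dd _)))) -(w22 (nd_nat ε)).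
rewrite (w2 (m2 (Meps_tau _ _))) (w2 (m2 (eps_nat δ))) MM !compA Meps_Dd.
by rewrite ndE !compA (w22 (esym (Md_d _))) Md_Md !d_d.
Qed.

Definition capd n y : H n.+1 n := class R (compt (match_term PF n y) (down n)).
Lemma capdE n y : capd n y = cap n y ⊙ δ.
Proof. exact: class_comp. Qed.

Lemma capd_d n y : capd n y ⊙ δ = capd n y.
Proof. by rewrite !capdE compA d_d. Qed.

Lemma edge_capd n x y : edge n x y = capd n y ⊙ cp n x.
Proof. by rewrite edgeE !capdE compA. Qed.

Lemma cap_nd n y : y < n -> cap n y ⊙ nd n = capd n y ⊙ M' (capd n y).
Proof.
move=> yn; rewrite ndE (w22 (cap_nab R hK yn)) !capdE MM !compA.
by rewrite Md_d -(w22 (d_nat hK (cap n y))).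
Qed.

(** The order is the composite of nd and Dd, that is, of two parallel order
steps. *)
Lemma edge_idem n x y : x < n -> y < n ->
  edge n x y ⊙ edge n x y = edge n x y.
Proof.
move=> xn yn; symmetry; rewrite {1}edgeE -nd_Dd !compA (w22 (cap_nd yn)).
rewrite !DdE !compA Del_cp // (w2 (m2 (capd_d _ _))).
rewrite -(w22 (d_nat hK (cp n x))) (w2 (m2 (esym (edge_capd _ _ _)))).
rewrite (w22 (d_nat hK _)) (w2 (capd_d _ _)) -(link_edge R hK).
by rewrite -compA -edge_capd.
Qed.

Definition upA n : H n.+1 n.+1 := class R (up n).

Lemma upE n : upA n = M' (ε ⊙ ∇ ⊙ δ) ⊙ Δ ⊙ η.
Proof. by rewrite /upA /up !class_comp !class_M !MM !compA. Qed.

Lemma down_up n : ∇ ⊙ M' δ ⊙ upA n.+1 ⊙ Δ = 𝟏.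
Proof.
have split_class (u : term PF n.+2 n.+2) :
    class R (nabla n ∘ M (down n) ∘ u ∘ Delta n)%term =
    ∇ ⊙ M' δ ⊙ class R u ⊙ Δ.
  by rewrite !class_comp !class_M !compA.
by rewrite -(split_class (up n.+1)); apply: pre_eq; constructor.
Qed.

Lemma up_nat a b (f : H a b) : M' f ⊙ upA a = upA b ⊙ M' f.
Proof.
have E : f ⊙ ε ⊙ ∇ ⊙ δ = ε ⊙ ∇ ⊙ δ ⊙ M' (M' f).
  by rewrite -(d_nat hK (M' f)) (w22 (nab_nat f)) (w22 (eps_nat f)).
by rewrite !upE -compA -MM E !MM !compA -(eta_nat (M' f)) (w22 (Del_nat _)).
Qed.

(** The arrow up outputs a fresh wire below its input. *)
Lemma cap_up_cp n x y : cap n y ⊙ upA n ⊙ cp n x = edge n y x.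
Proof.
have lk : link (ε ⊙ ∇ ⊙ dA R n.+1) y.+2 y.
  by apply: link_comp (link_eps R n y); apply: link_comp (link_nab R hK _ y.+2);
     apply: link_d hK _ _.
rewrite upE !compA (w22 (cap_link lk)).
rewrite -cp0 -(compA (cap _ _)) -/(eqv _ _ _ _) (w2 (eqv_eta R hK _ _)).
rewrite edgeE capE cpS !compA -(cp_comm R n x y).
by rewrite -(w22 (d_nat hK (cp n x))).
Qed.

(** The axiom on up and down: the wires that are both above and below x are
those equal to x. *)
Lemma edge_eqv n x y : x < n -> y < n ->
  edge n x y ⊙ edge n y x = eqv R n x y.
Proof.
move=> xn yn; rewrite /eqv -[cp n x]comp1f -down_up !compA.
rewrite (w22 (cap_nab R hK yn)) Del_cp // -(w22 (up_nat (cp n x))).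
rewrite -/(dA R _) (w2 (m2 (esym (capdE n y)))).
rewrite (w2 (m2 (esym (edge_capd _ _ _)))).
rewrite (w22 (up_nat _)) -(link_edge R hK) (w3 (cap_up_cp _ _ _)).
exact: edge_comm.
Qed.

Lemma PF_refl n x : x < n -> edge n x x = 𝟏.
Proof. by move=> xn; rewrite -edge_idem // edge_eqv // eqv_refl. Qed.

(** Tests the outermost wire to be below all the wires of U and drops it. Using
Dd for the copies makes the bialgebra law applicable. *)
Fixpoint below n (U : seq nat) : H n.+1 n :=
  if U is y :: U then below n U ⊙ M' (cap n y) ⊙ Dd n else ε.

Lemma below_d n U : below n U ⊙ δ = below n U.
Proof. by case: U => [|y U] /=; rewrite ?eps_d // !compA Dd_d. Qed.

Lemma below_cons n y U : below n (y :: U) = below n U ⊙ edge n.+1 0 y.+1.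
Proof.
rewrite /= -{2}below_d edge0S // MM !compA DdE.
by rewrite (w22 (Md_d _)) -(w22 (d_nat hK (cap n y))).
Qed.

Lemma cap_eta n y : cap n y ⊙ η = 𝟏.
Proof. by rewrite capE !compA eta_nat (w2 (nab_eta _ _)) comp1f eps_cp. Qed.

Lemma below_eta n U : below n U ⊙ η = 𝟏.
Proof.
elim: U => [|y U IH] /=; first exact: eps_eta.
by rewrite !compA Dd_eta (w2 (m2 (cap_eta _ _))) M1 comp1f.
Qed.

(** Two tests that consume a wire each may be made in either order. *)
Definition cocomm n (f g : H n.+1 n) := f ⊙ M' g = g ⊙ M' f ⊙ τ.

Lemma cap_cocomm n y z : cocomm (cap n y) (cap n z).
Proof.
rewrite /cocomm (_ : M' (cap n y) ⊙ τ = cap n.+1 y.+1); last by rewrite capS.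
by rewrite (cap_link (link_cap R hK n z y)).
Qed.

Lemma Dd_tau n : τ ⊙ M' τ ⊙ Dd n.+1 = M' (Dd n) ⊙ τ.
Proof.
have E : M' τ ⊙ M' (dA R n.+1) = M' (M' δ) ⊙ M' τ by rewrite -!MM tau_d'.
rewrite !DdE (w22 E) (w22 (tau_nat δ)) (w22 (d_nat hK τ)).
by rewrite (w22 (tau_d' R hK _)) -MDel_tau !MM !compA.
Qed.

Lemma cap_capd n y z :
  cap n y ⊙ M' (capd n z) = capd n z ⊙ M' (cap n y) ⊙ τ.
Proof.
rewrite !capdE MM (w23 (cap_cocomm _ _ _)) (tau_d R hK) !compA.
by rewrite (w22 (d_nat hK (cap n y))).
Qed.

Lemma below_cocomm n U z : cocomm (below n U) (capd n z).
Proof.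
rewrite /cocomm; elim: U => [|y U IH] /=.
  by rewrite Meps_tau eps_nat.
rewrite !compA -(Dd_nat (capd n z)) (w2 (m2 (cap_capd _ _ _))) !MM !compA.
by rewrite (w23 IH) (w22 (tau_nat (cap n y))) Dd_tau.
Qed.

(** The elements below U are closed under the join nd, and a join is below U only
if its parts are. The bialgebra law distributes the copies over the join;
induction treats the first copies and cap_nd the second ones, up to the order
in which the tests are made. *)
Lemma below_nd n U : all (fun y => y < n) U ->
  below n U ⊙ nd n = below n U ⊙ M' (below n U).
Proof.
elim: U => [|y U IH] /=; first by rewrite eps_nd.
case/andP=> yn /IH{}IH; rewrite !compA bialg (w2 (m2 (cap_nd yn))) MM !compA.
rewrite -(w22 (nd_nat (M' (capd n y)))) -(w22 (nd_nat (capd n y))) (w22 IH).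
set b := below n U in IH *.
have E : M' (capd n y) ⊙ Dd n = M' (cap n y) ⊙ Dd n.
  by rewrite capdE MM compA Md_Dd.
have -> : M' (M' (M' (capd n y))) ⊙ M' τ ⊙ M' (M' (Dd n)) ⊙ Dd n.+1 =
          M' τ ⊙ M' (M' (M' (cap n y) ⊙ Dd n)) ⊙ Dd n.+1.
  by rewrite -(w22 (Mtau_nat (capd n y))) -E !MM !compA.
have F : b ⊙ M' (capd n y) ⊙ τ = capd n y ⊙ M' b.
  by rewrite -(compA b) (below_cocomm n U y) !compA tauK compf1.
have {}F := congr1 (@MA _ _ _ _) F.
rewrite (MM b) (MM (M' _)) in F; rewrite (w3 F) MM !compA.
by rewrite (w2 (m2 (m2 (erefl _)))) Dd_nat (w22 E).
Qed.

Lemma below_cp n U x : x < n ->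
  below n U ⊙ cp n x = edges n [seq (x, y) | y <- U].
Proof.
move=> xn; elim: U => [|y U IH]; first exact: eps_cp.
rewrite below_cons compA -(edge_link hK (link_cp0 R xn) (link_cp R n x y)).
by rewrite -compA IH /= edges_cons edges_edge.
Qed.

Fixpoint above n (L : seq nat) : H n n.+1 :=
  if L is x :: L then edge n.+1 x.+1 0 ⊙ above n L else η.

(** Both forms of above are needed: as a product of edges it commutes with other
edges, and as an iterated join nd it meets below_nd. *)
Lemma d_above n L : δ ⊙ above n L = above n L.
Proof.
elim: L => [|x L IH] /=; first exact: d_eta.
rewrite -IH (edgeS0 R hK) MM !compA.
have -> : ∇ ⊙ M' δ ⊙ M' (cp n x) ⊙ δ ⊙ above n L =
          nd n ⊙ M' (cp n x) ⊙ above n L.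
  by rewrite (w22 (d_nat hK (cp n x))) ndE !compA.
by rewrite (w2 (d_nd _)).
Qed.

Lemma above_nd n x L :
  edge n.+1 x.+1 0 ⊙ above n L = nd n ⊙ M' (cp n x) ⊙ above n L.
Proof.
rewrite -{1}d_above (edgeS0 R hK) MM !compA.
by rewrite (w22 (d_nat hK (cp n x))) ndE !compA.
Qed.

Lemma above_Ed n L G : M' (edges n G) ⊙ above n L = above n L ⊙ edges n G.
Proof.
elim: L => [|x L IH] /=; first exact: eta_nat.
by rewrite compA -IH edges_M // -!compA edges_edge.
Qed.

(** Quantifier elimination: some k with L <= k <= U exists if and only if every
wire of L is below every wire of U. *)
Lemma below_above n L U : all (fun x => x < n) L -> all (fun y => y < n) U ->
  below n U ⊙ above n L = edges n [seq (x, y) | x <- L, y <- U].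
Proof.
move=> + Un; elim: L => [|x L IH] /=; first by rewrite below_eta.
case/andP=> xn /IH{}IH; rewrite above_nd (w22 (below_nd Un)).
rewrite (w2 (m2 (below_cp U xn))) above_Ed -compA IH edges_comm //.
by rewrite -edges_cat.
Qed.

(** Eliminating k from x <= k, y <= k, k <= z and k <= y gives x <= z besides
x <= y and y <= z. Here k can only be y, so that these two conditions are
already equivalent to the existence of k. *)
Lemma PF_trans n x y z m (s : H m n) : x < n -> y < n -> z < n ->
  edge n x y ⊙ s = s -> edge n y z ⊙ s = s -> edge n x z ⊙ s = s.
Proof.
move=> xn yn zn xy yz.
have := @below_above n [:: x; y] [:: z; y]; rewrite /= xn yn zn => /(_ isT isT).
rewrite -/(below n [:: z; y]) 2!below_cons /= !compA.
rewrite (w22 (edge_comm R hK _ 0 y.+1 0 z.+1)).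
rewrite (w22 (edge_comm R hK _ 0 y.+1 x.+1 0)).
rewrite (w2 (edge_eqv _ _)) // eqv_eta //.
have y0 := link_cp0 R yn; have yS := link_cp R n y.
rewrite -(edge_link hK (yS x) y0) -(w22 (edge_link hK y0 (yS z))).
rewrite (w2 (eps_cp _ _ _)) comp1f => /(congr1 (fun f => f ⊙ s)).
rewrite !edges_cons /= !compA xy yz comp1f PF_refl // comp1f yz xy => {2}->.
by [].
Qed.

Lemma PF_Del n : graph_state (Δ ⊙ fresh n.+1).
Proof.
exists [:: (0, 1); (1, 0)] => //.
rewrite !edges_cons compf1 (freshS _ n.+1) !compA (w2 (edge_eqv _ _)) //.
by rewrite (w2 (eqv_eta R hK _ _)).
Qed.

(** The edges at the wire 0 are sorted into those ending there (L), those
starting there (U) and the loop, which is trivial. *)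
Lemma PF_elim n (s : H 0 n.+1) : graph_state s -> graph_state (ε ⊙ s).
Proof.
case=> G aG ->; rewrite freshS -(compA (edges _ _)).
have [L [U [G' [aL aU aG' ->]]]] : exists L U G',
    [/\ all (fun x => x < n) L, all (fun y => y < n) U, all (in_range n) G' &
      edges n.+1 G ⊙ η =
        edges n.+1 [seq (0, y.+1) | y <- U] ⊙ above n L ⊙ edges n G'].
  elim: G aG => [|e G IH] /=.
    by exists [::], [::], [::]; rewrite !comp1f compf1.
  case/andP=> ae /IH[L [U [G' [aL aU aG' eG]]]].
  rewrite edges_cons compA eG; case: e ae => -[|i] [|j] /andP[/= i1 j1].
  - by exists L, U, G'; split=> //; rewrite PF_refl // comp1f.
  - exists L, (j :: U), G'; split=> //=; first by rewrite aU andbT.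
    by rewrite edges_cons !compA.
  - exists (i :: L), U, G'; split=> //=; first by rewrite aL andbT.
    by rewrite -!compA edges_edge.
  - exists L, U, ((i, j) :: G'); split=> //=.
      by rewrite aG' andbT; apply/andP.
    have := above_Ed n L [:: (i, j)].
    rewrite !edges_cons compf1 (M_edge R hK) /= => E.
    by rewrite -(w22 E) -!compA edges_edge.
exists ([seq (x, y) | x <- L, y <- U] ++ G').
  rewrite all_cat aG' andbT; apply/allP => _ /allpairsP[[x y] [/= xL yU ->]].
  by rewrite /in_range (allP aL) // (allP aU).
rewrite -!compA.
have -> : ε ⊙ edges n.+1 [seq (0, y.+1) | y <- U] = below n U.
  elim: U {aU} => [|y U IH]; first by rewrite compf1.
  by rewrite below_cons -IH /= edges_cons edges_edge // !compA.
by rewrite below_above // edges_cat.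
Qed.

(** A wire with no lower bound imposed can be chosen low: both demands on it are
upper bounds. *)
Lemma d_edge_eta n y : δ ⊙ edge n.+1 0 y.+1 ⊙ η = η.
Proof.
rewrite (edge0S R hK) MM !compA -(w22 (d_nat hK (cap n y))) -(w22 (Md_d _)).
by rewrite (w3 (esym (DdE n))) Dd_eta (w2 (m2 (cap_eta _ _))) M1 comp1f.
Qed.

End Preordering.

(** * Collapse through the object 0 *)

Section Collapse.

Variables (K : notion) (R : congruence K).

Local Notation H := (arrow R).

Lemma collapse :
    (forall n, η ⊙ epsA R n = 𝟏) -> (forall f g : H 0 0, f = g) ->
  preorder (quotient R).
Proof.
move=> E scal a b f g; change (H a b) in f; change (H a b) in g.
elim: a f g => [|a IH] f g; last first.
  by rewrite -(compf1 f) -(compf1 g) -E -!compA (IH (f ⊙ η) (g ⊙ η)).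
elim: b f g => [|b IH] f g; first exact: scal.
by rewrite -(comp1f f) -(comp1f g) -E !compA (IH (ε ⊙ f) (ε ⊙ g)).
Qed.

End Collapse.

(** * States of Frobenius monads *)

Section States.

Variables (K : notion) (R : congruence K).
Hypothesis hK : K <> RB.

Local Notation H := (arrow R).
Local Notation cp := (cp R).
Local Notation edge := (edge R).
Local Notation edges := (edges R).
Local Notation fresh := (fresh R).

Lemma edge_refl n x : x < n -> edge n x x = 𝟏.
Proof. by case: K R hK => // R' _; [exact: PF_refl | exact: EF_refl]. Qed.

Lemma edge_trans n x y z m (s : H m n) : x < n -> y < n -> z < n ->
  edge n x y ⊙ s = s -> edge n y z ⊙ s = s -> edge n x z ⊙ s = s.
Proof. by case: K R hK s => // R' _; [exact: PF_trans | exact: EF_trans]. Qed.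

Lemma edge_sym n x y : K = EF -> edge n x y = edge n y x.
Proof. by case: K R => // R' _; rewrite !EF_edge eqv_sym. Qed.

Lemma edge_sq n x y : x < n -> y < n -> edge n x y ⊙ edge n x y = edge n x y.
Proof.
case: K R hK => // R' _ xn yn; first exact: edge_idem.
rewrite !EF_edge {1}/eqv compA (cp_eqv R' EF_RB xn yn).
by rewrite -compA -/(eqv R' n y y) eqv_refl // comp1f.
Qed.

Lemma state_eps n (s : H 0 n.+1) : graph_state s -> graph_state (ε ⊙ s).
Proof. by case: K R hK s => // R' _; [exact: PF_elim | exact: EF_elim]. Qed.

Lemma relabel_Del n : relabel (DelA R n).
Proof.
split; first by exists S => i; split=> //; exact: link_Del.
by case: K R hK => // R' _; [exact: PF_Del | exact: EF_Del].
Qed.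

(** That f sends graph states to graph states does not obviously pass to M f. This
class of arrows is closed under M, and its members preserve graph states. In
reg_drop, f brings the wire to be dropped into the outermost position. *)
Inductive regular : forall a b, H a b -> Prop :=
| reg_id n : regular (idA R n)
| reg_comp a b c (g : H b c) (f : H a b) :
    regular g -> regular f -> regular (g ⊙ f)
| reg_relabel a b (f : H a b) : relabel f -> regular f
| reg_edge n x y : x < n -> y < n -> regular (edge n x y)
| reg_drop n (f : H n.+1 n.+1) : relabel f -> regular (ε ⊙ f).

Lemma regular_M a b (f : H a b) : regular f -> regular (M' f).
Proof.
elim=> {a b f} [n|a b c g f _ IHg _ IHf|a b f rf|n x y xn yn|n f rf].
- by rewrite M1; exact: reg_id.
- by rewrite MM; exact: reg_comp.
- by apply/reg_relabel/relabel_M.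
- by rewrite M_edge //; exact: reg_edge.
(* M eps drops the second wire, which tau brings to the front *)
- rewrite MM -eps_tau compA; apply: reg_drop; apply: relabel_comp => //.
    exact: relabel_tau.
  exact: relabel_M.
Qed.

Lemma regular_state n m (f : H n m) :
  regular f -> forall s, graph_state s -> graph_state (f ⊙ s).
Proof.
elim=> {n m f} [n|a b c g f _ IHg _ IHf|a b f rf|n x y xn yn|n f rf] s gs.
- by rewrite comp1f.
- by rewrite compA; apply/IHg/IHf.
- exact: relabel_state.
- rewrite -(compf1 (edge n x y)) -(edges_cons R n (x, y) [::]).
  apply: graph_state_edges => //.
  by rewrite /= /in_range /= xn yn.
- by rewrite compA; apply/state_eps/relabel_state.
Qed.

(** The output of down is a fresh wire above the input wire, which is dropped. *)
Lemma regular_d n : regular (dA R n).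
Proof.
have -> : dA R n = M' ε ⊙ edge n.+2 1 0 ⊙ η.
  rewrite edgeS0 // !MM !compA eta_nat (w22 (eta_nat δ)).
  rewrite (w2 (nab_eta _ _)) comp1f cp0 (w22 (d_nat hK _)).
  by rewrite Meps_Del compf1.
apply: reg_comp; last apply: reg_comp.
- apply: regular_M; rewrite -(compf1 ε); apply: reg_drop; split.
    by exists id => i ?; split=> //; exact: link_id.
  by rewrite comp1f; exact: graph_state_fresh.
- exact: reg_edge.
- by apply/reg_relabel/relabel_eta.
Qed.

Lemma all_regular a b (f : H a b) : regular f.
Proof.
elim/generated_ind: a b / f => [n|a b c g f|a b f|n|n|n|n|n|n].
- exact: reg_id.
- exact: reg_comp.
- exact: regular_M.
- by apply/reg_relabel/relabel_nab.
- by apply/reg_relabel/relabel_Del.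
- by apply/reg_relabel/relabel_eta.
- rewrite -[ε]compf1; apply: reg_drop; split.
    by exists id => i ?; split=> //; exact: link_id.
  by rewrite comp1f; exact: graph_state_fresh.
- by apply/reg_relabel/relabel_tau.
- exact: regular_d.
Qed.

Lemma state_graph n (s : H 0 n) : graph_state s.
Proof.
rewrite -(compf1 s).
exact: regular_state (all_regular s) _ (graph_state_fresh R 0).
Qed.

(** The edge from x to y is a consequence of the formula s. *)
Definition absorbs n (s : H 0 n) x y := edge n x y ⊙ s = s.

Lemma edges_absorb n (s : H 0 n) G :
  (forall e, e \in G -> absorbs s e.1 e.2) -> edges n G ⊙ s = s.
Proof.
elim: G => [|e G IH] sG; first by rewrite comp1f.
rewrite edges_cons compA IH; first by apply: sG; rewrite mem_head.
by move=> e' e'G; apply: sG; rewrite in_cons e'G orbT.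
Qed.

Lemma absorbs_edges n G e : all (in_range n) G -> e \in G ->
  absorbs (edges n G ⊙ fresh n) e.1 e.2.
Proof.
rewrite /absorbs; elim: G => // e' G IH /= /andP[/andP[e1 e2] aG].
rewrite edges_cons in_cons !compA => /orP[/eqP ->|eG].
  by rewrite -(compA (edge _ _ _)) edge_sq.
by rewrite (w22 (edge_comm R hK _ _ _ _ _)) (IH aG eG).
Qed.

(** Each state absorbs the edges of the other one, so both are equal to the
conjunction of all these edges. *)
Lemma state_ext n (s t : H 0 n) : graph_state s -> graph_state t ->
    (forall x y, x < n -> y < n -> (absorbs s x y <-> absorbs t x y)) ->
  s = t.
Proof.
case=> G aG es [G' aG' et] st.
have Gt : edges n G ⊙ t = t.
  apply: edges_absorb => e eG; have /andP[e1 e2] := allP aG _ eG.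
  by apply/st => //; rewrite es; apply: absorbs_edges.
have G's : edges n G' ⊙ s = s.
  apply: edges_absorb => e eG; have /andP[e1 e2] := allP aG' _ eG.
  by apply/st => //; rewrite et; apply: absorbs_edges.
by rewrite -G's es -Gt et -!compA edges_comm.
Qed.

(** Frobenius algebras make wires self-dual: Delta . eta turns a source wire into
a target wire and eps . nabla turns it back. *)
Definition bend a b (f : H a.+1 b) : H a b.+1 := M' f ⊙ Δ ⊙ η.
Definition unbend a b (f : H a b.+1) : H a.+1 b := ε ⊙ ∇ ⊙ M' f.

Lemma bendK a b : cancel (@bend a b) (@unbend a b).
Proof.
move=> f; rewrite /unbend /bend !MM (w22 (nab_nat f)) (w22 (frobR R hK _)).
by rewrite nab_Meta compf1 (w22 (eps_nat f)) eps_Del compf1.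
Qed.

(** A colouring of the wires with two colours merges them into two wires. *)
Lemma fold_exists n (c : pred nat) : exists f : H n 2,
  (forall i, i < n -> link f i (c i)) /\ f ⊙ fresh n = fresh 2.
Proof.
elim: n c => [|n IH] c; first by exists (fresh 2); split=> //; rewrite compf1.
have [f [fl fz]] := IH (c \o S); case c0: (c 0).
  exists ((M' ∇ ⊙ τ) ⊙ M' f); split.
    case=> [_|i /fl fi]; rewrite ?c0.
      apply: link_comp (link_M0 f) _; apply: link_comp (link_tau R _ _) _.
      exact: link_MS (link_nab R hK _ 0).
    apply: link_comp (link_MS fi) _; apply: link_comp (link_tau R _ _) _.
    rewrite /=; case: (c i.+1) => /=; last exact: link_M0.
    exact: (@link_MS _ _ _ _ _ 1 0 (link_nab R hK _ 1)).
  rewrite freshS !compA (w22 (eta_nat f)) fz !freshS.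
  by rewrite (w2 (tau_eta _ _)) (w2 (m2 (nab_eta _ _))) M1 comp1f.
exists (∇ ⊙ M' f); split.
  case=> [_|i /fl fi]; rewrite ?c0.
    exact: link_comp (link_M0 f) (link_nab R hK _ 0).
  apply: link_comp (link_MS fi) _.
  exact: (link_nab R hK _ (c i.+1).+1).
by rewrite freshS !compA (w22 (eta_nat f)) fz !freshS (w2 (nab_eta _ _)) comp1f.
Qed.

Lemma edge10 : edge 2 1 0 ⊙ η = dA R 1 ⊙ Δ.
Proof.
rewrite (edgeS0 R hK) MM !compA eta_nat (w22 (eta_nat δ)) (w2 (nab_eta _ _)).
by rewrite comp1f.
Qed.

(** If the edge 1 0 is absorbed by two wires that are free, or are subject to 0 1
only, then the wires connected by an order step are free as well. In the first
case this is the hypothesis. In the second case the two edges together equate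
the wires; an order step on the wire 0 then leads from the wire 1 to a new wire,
whereas without the edge 1 0 it makes the new wire free. *)
Lemma edge_split (E : H 2 2) :
    E = 𝟏 \/ K <> EF /\ E = edge 2 0 1 ->
    edge 2 1 0 ⊙ E ⊙ fresh 2 = E ⊙ fresh 2 ->
  dA R 1 ⊙ Δ ⊙ etaA R 0 = η ⊙ η.
Proof.
have -> : fresh 2 = η ⊙ η by rewrite !freshS compf1.
case=> [->|[]]; first by rewrite !comp1f -compA edge10 compA.
case: K R hK E => // R' _ E _ -> /(congr1 (fun s => dA R' 1 ⊙ s)).
rewrite [in X in _ = X](w3 (d_edge_eta _ _ _)) => <-.
by rewrite (w2 (edge_eqv _ _ _)) // eqv_sym (w2 (eqv_eta R' PF_RB _ _)) cp0.
Qed.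

(** Merge U into the wire 1 and its complement into the wire 0. The edge from x to
y becomes 1 0, and as no edge of G leaves U, those of G become loops or 0 1; in
EF they do not enter U either, and become loops. *)
Lemma split_spider n x y (G : seq (nat * nat)) (U : pred nat) :
    all (in_range n) G -> x < n -> y < n -> U x -> ~~ U y ->
    (forall e, e \in G -> U e.1 -> U e.2) ->
    (K = EF -> forall e, e \in G -> U e.2 -> U e.1) ->
    absorbs (edges n G ⊙ fresh n) x y ->
  dA R 1 ⊙ DelA R 0 ⊙ η = η ⊙ η.
Proof.
move=> aG xn yn Ux Uy UG UG' abs.
have [f [fl fz]] := fold_exists n U.
have := congr1 (comp_arrow f) abs.
rewrite (w22 (edge_link hK (fl _ xn) (fl _ yn))) (w22 (edges_link hK fl aG)) fz.
rewrite Ux (negbTE Uy) {f fl fz abs}; apply: edge_split.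
elim: G aG UG UG' => [|e G IH] /=; first by left.
case/andP=> _ aG UG UG'.
have /IH{}IH : all (in_range n) G by [].
have /IH{}IH : forall e, e \in G -> U e.1 -> U e.2.
  by move=> e' e'G; apply: UG; rewrite in_cons e'G orbT.
have /IH{}IH : K = EF -> forall e, e \in G -> U e.2 -> U e.1.
  by move=> KE e' e'G; apply: UG' => //; rewrite in_cons e'G orbT.
have {}UG := UG e (mem_head _ _).
have {}UG' KE := UG' KE e (mem_head _ _).
rewrite edges_cons /=; case: (U e.1) (U e.2) UG UG' => -[] UG UG' /=.
- by rewrite edge_refl // comp1f.
- by have := UG isT.
- right; have KE : K <> EF by move=> /UG' /(_ isT).
  split=> //; case: IH => [->|[_ ->]]; first by rewrite compf1.
  by rewrite edge_sq.
- by rewrite edge_refl // comp1f.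
Qed.

(** Unbending the hypothesis gives down = eta . eps in PF, and 1 = eta . eps in EF.
In PF, up is then eta . eps too, and the axiom on up and down says that 1 is a
composite through eta . eps. *)
Lemma split_spider_collapse :
  (forall n, dA R n.+1 ⊙ Δ ⊙ η = η ⊙ η) -> forall n, η ⊙ epsA R n = 𝟏.
Proof.
move=> E.
have d_split n : dA R n = η ⊙ ε.
  have {}E : M' δ ⊙ Δ ⊙ η = M' η ⊙ etaA R n.
    rewrite -[M' δ ⊙ _]tauKx (w22 (tau_d R hK _)) (w2 (tau_Del _ _)) E.
    by rewrite (w2 (tau_eta _ _)).
  rewrite -[dA R n]bendK /bend E /unbend MM (w22 (nab_nat η)) nab_Meta compf1.
  by rewrite eps_nat.
case: K R hK d_split => // R' _ d_split n.
rewrite -(down_up R' n) !d_split.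
have -> : upA R' n.+1 = etaA R' _ ⊙ epsA R' _.
  rewrite upE !d_split (w2 (nab_eta _ _)) comp1f MM !compA.
  by rewrite (w2 (Meps_Del _ _)) comp1f eta_nat.
rewrite MM !compA (w2 (nab_Meta _ _)) comp1f.
by rewrite (w22 (eta_nat _)) eps_Del compf1.
Qed.

End States.

(** * Maximality for Frobenius monads *)

Lemma free_ext K p q (v w : term K p q) a b (f g : term K a b) :
  free_eq f g -> ext_eq v w f g.
Proof.
elim=> {a b f g} [a b f g|a b f|a b f g _|a b f g h _ fg _|
                  a b c g g' f f' _ gg _|a b f g _].
- exact: ext_ax.
- exact: ext_refl.
- exact: ext_sym.
- exact: ext_trans fg.
- exact: ext_comp gg.
- exact: ext_M.
Qed.

Lemma free_class_ext K p q (v w : term K p q) a b (f g : term K a b) :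
  class (free_cong K) f = class (free_cong K) g ->
  class (ext_cong v w) f = class (ext_cong v w) g.
Proof.
move=> /(@classP _ (free_cong K) _ _ _ _) fg.
by apply/(@classP _ (ext_cong v w) _ _ _ _); exact: free_ext.
Qed.

Lemma to_states K (hK : K <> RB) (R0 R1 : congruence K) a b (f g : term K a b) :
    class R1 f = class R1 g -> class R0 f <> class R0 g ->
  exists n, exists s t : term K 0 n,
    class R1 s = class R1 t /\ class R0 s <> class R0 t.
Proof.
elim: a b f g => [|a IH] b f g fg1 fg0; first by exists b, f, g.
pose bt (h : term K a.+1 b) := compt (M h) (compt (Delta a) (eta a)).
have btE R h : class R (bt h) = bend (class R h).
  by rewrite /bt /bend !class_comp class_M.
apply: (IH b.+1 (bt f) (bt g)); rewrite !btE; first by rewrite fg1.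
by move/(can_inj (@bendK _ R0 hK a b)).
Qed.

Lemma frobenius_maximal K (hK : K <> RB) p q (v w : term K p q) :
  class (free_cong K) v <> class (free_cong K) w ->
  preorder (ext_category v w).
Proof.
set R0 := free_cong K; set R1 := ext_cong v w => vw.
have vw1 : class R1 v = class R1 w.
  by apply/(@classP K R1 _ _ _ _); exact: ext_new.
have [n [s0 [t0 [eq1 neq0]]]] := to_states hK vw1 vw.
have [x [y [xn [yn [s [t [st1 xs xt]]]]]]] :
    exists x y, x < n /\ y < n /\ exists s t : term K 0 n,
      [/\ class R1 s = class R1 t, absorbs (class R0 s) x y
        & ~ absorbs (class R0 t) x y].
  apply: contrapT => h; apply: neq0.
  apply: state_ext => //; try exact: state_graph.
  move=> x y xn yn; split=> a; apply: contrapT => na; apply: h; exists x, y.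
    by split=> //; split=> //; exists s0, t0.
  by split=> //; split=> //; exists t0, s0.
have transfer := free_class_ext v w.
have [G aG tG] := state_graph hK (class R0 t).
have tG1 : class R1 t = edges R1 n G ⊙ fresh R1 n.
  by rewrite -class_comp; apply: transfer; rewrite class_comp.
have xy1 : absorbs (class R1 t) x y.
  by rewrite /absorbs -st1 -class_comp; apply: transfer; rewrite class_comp.
have tabs e : e \in G ->
    [/\ e.1 < n, e.2 < n & absorbs (class R0 t) e.1 e.2].
  move=> eG; have /andP[e1 e2] := allP aG _ eG; split=> //.
  by rewrite tG; apply: absorbs_edges.
(* the up-closure of x in the preorder of t *)
pose U i := `[< absorbs (class R0 t) x i >].
have split0 : dA R1 1 ⊙ DelA R1 0 ⊙ etaA R1 0 = etaA R1 1 ⊙ etaA R1 0.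
  rewrite tG1 in xy1; apply: (split_spider (U := U) hK aG xn yn _ _ _ _ xy1).
  - by apply/asboolP; rewrite /absorbs edge_refl // comp1f.
  - exact/asboolP.
  - move=> e /tabs[e1 e2 et] /asboolP xe; apply/asboolP.
    exact: edge_trans xe et.
  - move=> KE e /tabs[e1 e2 et] /asboolP xe; apply/asboolP.
    by apply: edge_trans xe _ => //; rewrite edge_sym.
have splitm m :
    dA R1 m.+1 ⊙ DelA R1 m ⊙ etaA R1 m = etaA R1 m.+1 ⊙ etaA R1 m.
  have E0 : ext_eq v w (compt (order_term K 1) (compt (Delta 0) (eta 0)))
                       (compt (eta 1) (eta 0)).
    by apply/(@classP K R1 _ _ _ _); rewrite !class_comp.
  have E : class R1 (compt (order_term K m.+1) (compt (Delta m) (eta m))) =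
           class R1 (compt (eta m.+1) (eta m)).
    apply/(@classP K R1 _ _ _ _).
    have -> : order_term K m.+1 = shift (order_term K 1) m by case: (K).
    exact: (ext_shift m E0).
  by move: E; rewrite !class_comp.
apply: collapse; first exact: split_spider_collapse.
(* a graph on no vertices has no edges *)
have scal (f : arrow R1 0 0) : f = idA R1 0.
  by have [[|e G'] // _ ->] := state_graph hK f; rewrite comp1f.
by move=> f g; rewrite (scal f) (scal g).
Qed.

(** * Boolean matrices in relational bialgebraic monads *)

(** Adjoins an outermost wire that is the sum of the wires of U. *)
Fixpoint row_term n (U : seq nat) : term RB n n.+1 :=
  if U is x :: U then compt (nabla n) (compt (M (row_term n U)) (copy_term n x))
  else eta n.

Fixpoint discard_term n : term RB n 0 :=
  if n is n.+1 then compt (discard_term n) (eps n) else idt 0.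

(** The target wire j is the sum of the source wires in rho j. *)
Fixpoint mat_term n b (rho : nat -> seq nat) : term RB n b :=
  if b is b.+1 then compt (M (mat_term n b (rho \o S))) (row_term n (rho 0))
  else discard_term n.

Section Bialgebra.

Variable R : congruence RB.

Local Notation H := (arrow R).
Local Notation cp := (cp R).
Local Notation fresh := (fresh R).

Lemma bialg_eq a b (f g : term RB a b) :
  bialgebra_ax f g -> class R f = class R g.
Proof. by move=> h; apply/classP/c_ax; right. Qed.

Lemma eps_nab n : ε ⊙ nabA R n = ε ⊙ M' ε.
Proof. by rewrite -class_M -!class_comp; apply: bialg_eq; constructor. Qed.

Lemma Del_eta n : DelA R n ⊙ η = M' η ⊙ η.
Proof. by rewrite -class_M -!class_comp; apply: bialg_eq; constructor. Qed.

Lemma Del_nab n : DelA R n ⊙ ∇ = M' ∇ ⊙ ∇ ⊙ M' τ ⊙ M' (M' Δ) ⊙ Δ.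
Proof.
by have := bialg_eq (ax_Delta_nabla RB n); rewrite !class_comp !class_M !compA.
Qed.

(** An absent wire reads as eta, which is copied like the other wires. *)
Lemma Del_cp_RB n x : Δ ⊙ cp n x = M' (cp n x) ⊙ cp n x.
Proof.
have [|nx] := ltnP x n; first exact: Del_cp.
elim: n x nx => [|n IHn] x nx; first by rewrite !cp_nil Del_eta.
case: x nx => // x nx; rewrite cpS MM !compA -(w22 (tau_nat _)) -MM -IHn // MM.
by rewrite (w23 (Del_tau _ _)).
Qed.

Lemma cp_out n x : n <= x -> cp n x = η.
Proof.
elim: n x => [//|n IHn] [//|x] nx.
by rewrite cpS IHn // tau_Meta.
Qed.

Definition row n U : H n n.+1 := class R (row_term n U).
Lemma row_nil n : row n [::] = η. Proof. by []. Qed.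
Lemma row_cons n x U : row n (x :: U) = ∇ ⊙ M' (row n U) ⊙ cp n x.
Proof.
rewrite -class_M.
exact: etrans (class_comp _ _ _) (congr1 _ (class_comp _ _ _)).
Qed.

(** This and the next lemmas make the target wires of a matrix independent: they
may be exchanged, dropped, copied and added without regard to the others. *)
Lemma row_comm n U V : comm (row n U) (row n V).
Proof.
elim: U => [|x U IH]; first exact: comm_eta.
rewrite row_cons; apply: comm_nab => //; apply: comm_sym.
elim: {IH} V => [|y V IH]; first exact: comm_eta.
by rewrite row_cons; apply: comm_nab => //; exact: cp_comm.
Qed.

Lemma eps_row n U : ε ⊙ row n U = 𝟏.
Proof.
elim: U => [|x U IH]; first exact: eps_eta.
by rewrite row_cons (w22 (eps_nab _)) (w2 (m2 IH)) M1 comp1f eps_cp.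
Qed.

Lemma row1 n x : row n [:: x] = cp n x.
Proof. by rewrite row_cons row_nil (w2 (nab_Meta _ _)) comp1f. Qed.

(** The bialgebra law copies a sum by copying its terms. *)
Lemma Del_row n U : Δ ⊙ row n U = M' (row n U) ⊙ row n U.
Proof.
elim: U => [|x U IH]; first exact: Del_eta.
rewrite {1}row_cons; set r := row n U in IH *.
rewrite (w2 (Del_nab _)) !compA -(w22 (Del_nat r)) Del_cp_RB.
rewrite (w2 (m2 (m2 IH))) !MM !compA.
have C : τ ⊙ M' r ⊙ cp n x = M' (cp n x) ⊙ r.
  have := row_comm n U [:: x]; rewrite row1 /comm => ->.
  by rewrite tauKx.
have T : M' τ ⊙ M' (M' (M' r)) = M' (M' (M' r)) ⊙ M' τ.
  by rewrite -!MM tau_nat.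
have {}C := congr1 (@MA _ _ _ _) C; rewrite !MM in C.
rewrite (w22 T) (w3 C) !compA (w22 (nab_nat (M' r))) (w22 (nab_nat (cp n x))).
by rewrite row_cons !MM !compA.
Qed.

Lemma row_cat n U V : row n (U ++ V) = ∇ ⊙ M' (row n V) ⊙ row n U.
Proof.
elim: U => [|x U IH] /=.
  by rewrite row_nil eta_nat (w2 (nab_eta _ _)) comp1f.
rewrite !row_cons IH !MM !compA -(w22 (nab_nat (row n V))).
by rewrite (w22 (nabAss _ _)).
Qed.

Lemma row_catC n U V : row n (U ++ V) = row n (V ++ U).
Proof. by rewrite !row_cat row_comm (w2 (nab_tau _ _)). Qed.

Lemma row_dup n U : row n (U ++ U) = row n U.
Proof. by rewrite row_cat -Del_row (w2 (sepA _ _)) comp1f. Qed.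

Lemma row_perm n U V : perm_eq U V -> row n U = row n V.
Proof.
apply: (catCA_perm_subst (F := row n)) => s1 s2 s3.
by rewrite !catA row_cat row_catC -row_cat.
Qed.

Lemma row_undup n U : row n (undup U) = row n U.
Proof.
elim: U => //= x U IH; case: ifP => [xU|_]; last by rewrite !row_cons IH.
rewrite IH (row_perm n (perm_to_rem xU)).
move: (rem x U) (perm_to_rem xU) => W UW.
have /(row_perm n)-> : perm_eq (x :: U) (([:: x] ++ [:: x]) ++ W).
  by rewrite perm_cons.
by rewrite row_cat row_dup -row_cat.
Qed.

Lemma row_filter n U : row n [seq x <- U | x < n] = row n U.
Proof.
elim: U => //= x U IH; case: ltnP => nx; rewrite !row_cons IH //.
by rewrite cp_out // eta_nat (w2 (nab_eta _ _)) comp1f.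
Qed.

(** Sums are commutative, and idempotent by separability; hence they depend on
the set of their terms only. *)
Lemma row_ext n U V : (forall i, i < n -> (i \in U) = (i \in V)) ->
  row n U = row n V.
Proof.
move=> UV; rewrite -row_filter -[row n V]row_filter.
rewrite -row_undup -[row n (filter _ V)]row_undup.
apply: row_perm; apply: uniq_perm; rewrite ?undup_uniq // => i.
by rewrite !mem_undup !mem_filter; case: ltnP => //= /UV.
Qed.

Definition discard n : H n 0 := class R (discard_term n).
Lemma discardS n : discard n.+1 = discard n ⊙ ε.
Proof. exact: class_comp. Qed.

Definition mat n b rho : H n b := class R (mat_term n b rho).
Lemma mat0 n rho : mat n 0 rho = discard n. Proof. by []. Qed.
Lemma matS n b rho :
  mat n b.+1 rho = M' (mat n b (rho \o S)) ⊙ row n (rho 0).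
Proof. by rewrite -class_M; exact: class_comp. Qed.

Lemma mat_ext n b rho sigma :
    (forall i j, i < n -> j < b -> (i \in rho j) = (i \in sigma j)) ->
  mat n b rho = mat n b sigma.
Proof.
elim: b rho sigma => // b IH rho sigma E; rewrite !matS; congr (M' _ ⊙ _).
  by apply: IH => i j ii jb; apply: E.
by apply: row_ext => i ii; apply: E.
Qed.

Lemma Meps_row n U : M' ε ⊙ row n.+1 (map S U) = row n U ⊙ ε.
Proof.
elim: U => [|x U IH] /=; first by rewrite row_nil eta_nat.
rewrite !row_cons -(w22 (nab_nat ε)) !compA (w2 (m2 IH)) MM !compA.
by rewrite -(link_eps R n x).
Qed.

Lemma mat_eps n b rho : mat n.+1 b (map S \o rho) = mat n b rho ⊙ ε.
Proof.
elim: b rho => [|b IH] rho; first by rewrite mat0 discardS.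
rewrite !matS; have -> : (map S \o rho) \o S = map S \o (rho \o S) by [].
by rewrite IH MM !compA Meps_row.
Qed.

Lemma mat_id n : mat n n (fun i => [:: i]) = 𝟏.
Proof.
elim: n => [//|n IH]; rewrite matS row1 cp0.
have -> : (fun i => [:: i]) \o S = map S \o (fun i => [:: i]) by [].
by rewrite mat_eps IH comp1f Meps_Del.
Qed.

Definition row_scons (U : seq nat) rho j : seq nat :=
  if j is j.+1 then rho j else U.

(** Postcomposition with f acts on matrices. Unlike the mere existence of a matrix
for f, this is immediate for composites. *)
Definition linear a b (f : H a b) :=
  forall n rho, exists sigma, f ⊙ mat n a rho = mat n b sigma.

Lemma all_linear a b (f : H a b) : linear f.
Proof.
elim/generated_ind: a b / f => [n|a b c g f lg lf|a b f lf|n|n|n|n|n|n] m rho.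
- by exists rho; rewrite comp1f.
- have [rho' E] := lf m rho; have [rho'' E'] := lg m rho'.
  by exists rho''; rewrite compA E E'.
- have [rho' E] := lf m (rho \o S); exists (row_scons (rho 0) rho').
  by rewrite !matS -compA -MM E.
- exists (row_scons (rho 0 ++ rho 1) (rho \o S \o S)).
  by rewrite !matS MM !compA (w22 (nab_nat _)) row_cat.
- exists (row_scons (rho 0) rho).
  by rewrite !matS -(w22 (Del_nat _)) Del_row !MM !compA.
- by exists (row_scons [::] rho); rewrite !matS row_nil eta_nat.
- by exists (rho \o S); rewrite !matS (w22 (eps_nat _)) eps_row compf1.
- exists (row_scons (rho 1) (row_scons (rho 0) (rho \o S \o S))).
  by rewrite !matS !MM !compA (w22 (tau_nat _)) row_comm tauKx.
- by exists rho; rewrite comp1f.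
Qed.

Lemma matP a b (f : H a b) : exists rho, f = mat a b rho.
Proof.
have [rho E] := all_linear f a (fun i => [:: i]).
by exists rho; rewrite -E mat_id compf1.
Qed.

Lemma cp_mat n b rho j : j < b ->
  cp b j ⊙ mat n b rho = M' (mat n b rho) ⊙ row n (rho j).
Proof.
elim: b j rho => // b IH [|j] rho jb; rewrite !matS ?cp0 ?cpS ?compA.
  by rewrite -(w22 (Del_nat _)) Del_row !MM !compA.
by rewrite (w2 (m2 (IH j _ jb))) !MM !compA (w22 (tau_nat _)) -row_comm.
Qed.

Lemma discard_mat n b rho : discard b ⊙ mat n b rho = discard n.
Proof.
elim: b rho => [|b IH] rho; first by rewrite mat0 -[discard 0]/𝟏 comp1f.
by rewrite matS discardS compA (w22 (eps_nat _)) eps_row compf1 IH.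
Qed.

Lemma cp_fresh n x : cp n x ⊙ fresh n = η ⊙ fresh n.
Proof.
elim: n x => [|n IH] [|x] //; rewrite freshS ?cp0 ?cpS.
  by rewrite (w22 (Del_eta _)) (w22 (eta_nat _)).
by rewrite !compA (w22 (eta_nat _)) IH (w2 (tau_eta _ _)) (w22 (eta_nat _)).
Qed.

(** The wire i, all other wires being zero; with no wires at all, eps is a default
value. *)
Fixpoint wire n i : H 1 n :=
  match n with
  | 0 => ε
  | n.+1 => if i is i.+1 then η ⊙ wire n i else M' (fresh n)
  end.

Lemma discard_wire n i : i < n -> discard n ⊙ wire n i = ε.
Proof.
elim: n i => // n IH [|i] ni /=; rewrite discardS compA.
  rewrite eps_nat -compA -[RHS]comp1f; congr (_ ⊙ _).
  elim: n {IH ni} => [|n IH]; first exact: comp1f.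
  by rewrite discardS freshS compA (w2 (eps_eta _ _)) comp1f.
by rewrite (w2 (eps_eta _ _)) comp1f IH.
Qed.

Lemma cp_wire n i x : i < n ->
  cp n x ⊙ wire n i = if x == i then M' (wire n i) ⊙ Δ else η ⊙ wire n i.
Proof.
elim: n i x => // n IH [|i] [|x] ni; rewrite ?cp0 ?cpS ?compA /=.
- by rewrite -(Del_nat (fresh n)).
- by rewrite -MM cp_fresh MM (w2 (tau_Meta _ _)).
- by rewrite (w22 (Del_eta _)) (w22 (eta_nat _)).
- rewrite (w22 (eta_nat _)) (w2 (tau_eta _ _)) IH // eqSS.
  by case: eqP => _; rewrite ?MM ?compA // (w22 (eta_nat _)).
Qed.

Lemma row_wire n i U : i < n ->
  row n U ⊙ wire n i = if i \in U then M' (wire n i) ⊙ Δ else η ⊙ wire n i.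
Proof.
move=> ni; elim: U => // x U IH.
rewrite row_cons in_cons !compA cp_wire // eq_sym; case: eqP => [_|_] /=.
  rewrite (w2 (m2 IH)); case: ifP => _; rewrite MM !compA.
    by rewrite (w22 (nab_nat _)) -DelAss (w2 (sepA _ _)) comp1f.
  by rewrite (w2 (nab_Meta _ _)) comp1f.
by rewrite (w22 (eta_nat _)) (w2 (nab_eta _ _)) comp1f IH.
Qed.

(** Feeding the wire i and observing the wire j evaluates the entry at (i, j) of
the matrix to one of the two arrows that it can be. *)
Lemma mat_collapse p q rho sigma i j : i < p -> j < q ->
    i \in rho j -> i \notin sigma j -> mat p q rho = mat p q sigma ->
  η ⊙ epsA R 0 = 𝟏.
Proof.
move=> ip jq ir is_ E.
have entry tau : M' (discard q) ⊙ cp q j ⊙ mat p q tau ⊙ wire p i =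
                 if i \in tau j then 𝟏 else η ⊙ ε.
  rewrite (w22 (cp_mat _ _ jq)) (w2 (m2 (discard_mat _ _ _))) row_wire //.
  case: ifP => _; first by rewrite (w2 (m2 (discard_wire ip))) Meps_Del.
  by rewrite (w22 (eta_nat _)) discard_wire.
by have := entry rho; rewrite ir E (entry sigma) (negbTE is_).
Qed.

End Bialgebra.

Lemma bialgebra_maximal p q (v w : term RB p q) :
  class (free_cong RB) v <> class (free_cong RB) w ->
  preorder (ext_category v w).
Proof.
set R0 := free_cong RB; set R1 := ext_cong v w => vw.
have transfer := free_class_ext v w.
have [[rho ev] [sigma ew]] := (matP (class R0 v), matP (class R0 w)).
have E : mat R1 p q rho = mat R1 p q sigma.
  apply: etrans (esym (transfer _ _ _ _ ev)) (etrans _ (transfer _ _ _ _ ew)).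
  by apply/(@classP _ R1 _ _ _ _); exact: ext_new.
have [i [j [ip [jq ij]]]] :
    exists i j, i < p /\ j < q /\ (i \in rho j) <> (i \in sigma j).
  apply: contrapT => h; apply: vw; rewrite ev ew; apply: mat_ext => i j ip jq.
  by apply: contrapT => ij; apply: h; exists i, j.
have id1 : etaA R1 0 ⊙ epsA R1 0 = idA R1 1.
  case ir: (i \in rho j) ij => ij.
    apply: (mat_collapse ip jq ir _ E).
    by apply/negP => h; apply: ij; rewrite h.
  have is_ : i \in sigma j by case: (i \in sigma j) ij.
  exact: (mat_collapse ip jq is_ (negbT ir) (esym E)).
apply: collapse => [n|f g].
  have E0 : ext_eq v w (compt (eta 0) (eps 0)) (idt 1).
    by apply/(@classP _ R1 _ _ _ _); rewrite class_comp.
  have : class R1 (compt (eta n) (eps n)) = class R1 (idt n.+1).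
    by apply/(@classP _ R1 _ _ _ _); exact: (ext_shift n E0).
  by rewrite class_comp.
by have [[r ->] [s ->]] := (matP f, matP g).
Qed.

Theorem mainTheorem4 (K : notion) (p q : nat) (v w : term K p q) :
  class (free_cong K) v <> class (free_cong K) w ->
  preorder (ext_category v w).
Proof.
case: K v w => v w; try exact: frobenius_maximal.
exact: bialgebra_maximal.
Qed.
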